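(* Let $k$ be a positive integer and let $G$ be a connected claw-free graph. If $\sigma_{k+4}(G)\geq |G|-k-1$, then $G$ has a spanning tree with at most $k$ branch vertices.
   Context: All graphs are finite and simple (no loops). $|G|$ denotes the number of vertices of $G$, and $\deg_G(v)$ the degree of $v$ in $G$. A graph is claw-free if it does not contain $K_{1,3}$ as an induced subgraph. $\alpha(G)$ denotes the largest size of an independent set of $G$. For an integer $j\geq 1$, $\sigma_j(G)=+\infty$ if $\alpha(G)<j$, and otherwise $\sigma_j(G)=\min\{\sum_{i=1}^j \deg_G(v_i) : \{v_1,\dots,v_j\}\text{ is an independent set of } j \text{ vertices of } G\}$. A branch vertex of a tree $T$ is a vertex of degree at least three in $T$. Inequalities are between (extended) real numbers, so the right-hand side may be negative. *)

(* Defs.v *)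
From mathcomp Require Import all_boot all_order all_algebra.
From mathcomp Require Import constructive_ereal.

Set Implicit Arguments.
Unset Strict Implicit.
Unset Printing Implicit Defensive.

Local Open Scope nat_scope.

(* A finite simple graph is a symmetric irreflexive relation on a finType,
   so |G| is #|T|. *)
Definition simple_graph (T : finType) (e : rel T) : Prop :=
  symmetric e /\ irreflexive e.

(* The graph without vertices is not considered connected. *)
Definition connected_graph (T : finType) (e : rel T) : Prop :=
  0 < #|T| /\ forall x y : T, connect e x y.

Definition degree (T : finType) (e : rel T) (v : T) : nat := #|[set u | e v u]|.

Definition induced_subgraph_of (U T : finType) (h : rel U) (e : rel T) : Prop :=
  exists f : U -> T, injective f /\ forall x y : U, e (f x) (f y) = h x y.

Definition complete_bipartite (m n : nat) : rel ('I_m + 'I_n)%type :=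
  fun u v =>
    match u, v with
    | inl _, inr _ | inr _, inl _ => true
    | _, _ => false
    end.

Definition claw_free (T : finType) (e : rel T) : Prop :=
  ~ induced_subgraph_of (@complete_bipartite 1 3) e.

Definition independent (T : finType) (e : rel T) (S : {set T}) : bool :=
  [forall x in S, forall y in S, ~~ e x y].

Definition independence_number (T : finType) (e : rel T) : nat :=
  \max_(S : {set T} | independent e S) #|S|.

(* Degree sums are integers, so \bar int contains all the extended reals
   involved. The minimum in the second branch is over a nonempty family; its
   neutral element +oo is never attained there. *)
Definition sigma (T : finType) (e : rel T) (j : nat) : \bar int :=
  if independence_number e < j then +oo%E
  else \big[Order.min/+oo%E]_(S : {set T} | independent e S && (#|S| == j))
         ((\sum_(v in S) degree e v)%N%:Z%:E).

Definition acyclic_graph (T : finType) (t : rel T) : Prop :=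
  forall c : seq T, 2 < size c -> ~ ucycle t c.

Definition tree (T : finType) (t : rel T) : Prop :=
  [/\ simple_graph t, connected_graph t & acyclic_graph t].

Definition spanning_tree (T : finType) (e t : rel T) : Prop :=
  tree t /\ subrel t e.

Definition branch_vertices (T : finType) (t : rel T) : {set T} :=
  [set v | 3 <= degree t v].

(* Main.v *)
(* Take a spanning tree t with the fewest leaves, l of them; they are independent.
   Root t at a branch vertex.  If a leaf u is adjacent to v, then adding uv and
   deleting the edge from v towards u gives another tree with at most l leaves, so
   the neighbour q of v on the path to u is not a branch vertex and is adjacent to
   no leaf other than u.  With claw-freeness, v has at most one leaf neighbour
   below it and at most one elsewhere; charging the former to v and the latter to
   the parent of v shows that the leaves have degree sum at most n - l.  This
   settles l >= k + 4, and l <= k + 2 leaves at most k branch vertices.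

   Let l = k + 3 and suppose every spanning tree has more than k branch vertices.
   Then every tree with l leaves has maximum degree 3 and at least two branch
   vertices.  Among all such trees choose branch vertices b, b' at minimal distance
   and root at b, with children y, z, w where w leads to b'.  Minimality makes y and
   z adjacent, so the triangle b, y, z can be opened in three ways, and exchanges
   either reduce the leaves, create a vertex of degree 4, or bring two branch
   vertices closer.  Hence b and b' are adjacent to no leaf, and every neighbour of b
   in the graph other than y, z, w can also be charged to its parent.  As b and b'
   themselves are never charged, the l + 1 = k + 4 independent vertices formed by b
   and the leaves have degree sum at most n - l + 3 - 2 = n - k - 2. *)
Require Import Defs.
From mathcomp Require Import all_boot all_order all_algebra zify.
From mathcomp Require Import constructive_ereal.
From Stdlib Require Import Classical_Prop.

Set Implicit Arguments.
Unset Strict Implicit.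
Unset Printing Implicit Defensive.
Local Open Scope nat_scope.

(** * Preliminaries on natural numbers *)

Lemma nat_minimum (P : nat -> Prop) :
  (exists n, P n) -> exists2 n, P n & forall m, P m -> n <= m.
Proof.
case=> n; elim/ltn_ind: n => n IH Pn.
have [[m [lt_mn Pm]]|no] := classic (exists m, m < n /\ P m).
  exact: IH lt_mn Pm.
exists n => // m Pm; rewrite leqNgt; apply/negP => lt_mn.
by apply: no; exists m.
Qed.

(** Turns degree bounds into degree equations once the totals are known to agree. *)
Lemma eq_leq_sum (I : finType) (f g : I -> nat) :
  (forall i, f i <= g i) -> \sum_i g i <= \sum_i f i -> forall i, f i = g i.
Proof.
move=> le_fg le_sum i; move: le_sum; rewrite (bigD1 i) //= [leqRHS](bigD1 i) //=.
have: \sum_(j | j != i) f j <= \sum_(j | j != i) g j by apply: leq_sum.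
by have := le_fg i; lia.
Qed.

(** * Rooted trees *)

Section Rooted.

Variable T : finType.
Implicit Types (t : rel T) (par : T -> T) (dep : T -> nat).

Lemma degreeE t v : degree t v = \sum_w t v w.
Proof. by rewrite /degree cardsE -sum1_card big_mkcond. Qed.

(** A tree given by parent pointers. The depth excludes cycles, and a root that is its own parent
    makes ancestry plain iteration of [par]. *)
Record rooting t r par dep : Prop := Rooting {
  rt_root : par r = r;
  rt_dep0 : dep r = 0;
  rt_dep : forall v, v != r -> dep v = (dep (par v)).+1;
  rt_rel : forall x y,
    t x y = ((x != r) && (par x == y)) || ((y != r) && (par y == x)) }.

(** The ancestor comes first, and every vertex is its own ancestor. *)
Definition anc par (c a : T) : bool := fconnect par a c.

Section RootedTheory.

Variables (t : rel T) (r : T) (par : T -> T) (dep : T -> nat).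
Hypothesis rt : rooting t r par dep.
Local Notation anc := (anc par).

Lemma ancP c a : reflect (exists n, iter n par a = c) (anc c a).
Proof.
apply: (iffP idP) => [H|[n <-]]; last exact: fconnect_iter.
by exists (findex par a c); apply: iter_findex.
Qed.

Lemma anc_refl a : anc a a. Proof. exact: connect0. Qed.

Lemma anc_trans b a c : anc a b -> anc b c -> anc a c.
Proof. by move=> ab bc; apply: connect_trans bc ab. Qed.

Lemma par_anc a : anc (par a) a. Proof. exact: fconnect1. Qed.

Lemma anc_par c a : anc c (par a) -> anc c a.
Proof. by move=> H; apply: anc_trans H (par_anc a). Qed.

Lemma anc_up c a : anc c a -> c != a -> anc c (par a).
Proof.
case/ancP=> -[|n] <-; first by rewrite eqxx.
by move=> _; rewrite iterSr; apply/ancP; exists n.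
Qed.

Lemma dep_par a : dep (par a) <= dep a.
Proof.
have [->|/(rt_dep rt)->] := eqVneq a r; last exact: leqnSn.
by rewrite (rt_root rt).
Qed.

Lemma par_neq v : v != r -> par v != v.
Proof. by move=> /(rt_dep rt) H; apply/eqP => E; rewrite E in H; lia. Qed.

Lemma anc_dep c a : anc c a -> dep c <= dep a.
Proof.
case/ancP=> n <-; elim: n => //= n IH.
exact: leq_trans (dep_par _) IH.
Qed.

(** Induction down the tree path from [c], carried out on the depth of [a]. *)
Lemma up_ind (Q : T -> Prop) c : Q c ->
  (forall a, a != r -> a != c -> anc c (par a) -> Q (par a) -> Q a) ->
  forall a, anc c a -> Q a.
Proof.
move=> Qc up a; move: {2}(dep a) (leqnn (dep a)) => n.
elim: n a => [|n IH] a le_an ca.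
  have [<- //|ne] := eqVneq c a.
  have [ar|/(rt_dep rt) H] := eqVneq a r; last by move: H le_an; lia.
  by have := anc_up ca ne; case/eqP: ne; case/ancP: ca => m <-;
    rewrite ar; elim: m => //= m ->; rewrite (rt_root rt).
have [<- //|ne] := eqVneq c a.
have cpa := anc_up ca ne.
have [ar|nr] := eqVneq a r.
  case/eqP: ne; case/ancP: ca => m <-.
  by rewrite ar; elim: m => //= m ->; rewrite (rt_root rt).
apply: up => //; first by rewrite eq_sym.
by apply: IH => //; have := rt_dep rt nr; lia.
Qed.

Lemma anc_root_eq c : anc c r -> c = r.
Proof.
by case/ancP=> m <-; elim: m => //= m ->; rewrite (rt_root rt).
Qed.

Lemma root_anc a : anc r a.
Proof.
move: {2}(dep a) (leqnn (dep a)) => n.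
elim: n a => [|n IH] a le_an; have [->|nr] := eqVneq a r;
  rewrite ?anc_refl //; have H := rt_dep rt nr; first by lia.
by apply: anc_par; apply: IH; lia.
Qed.

Lemma anc_dep_eq c a : anc c a -> dep a <= dep c -> c = a.
Proof.
move=> ca le; have [//|ne] := eqVneq c a.
have nr : a != r.
  by apply: contraNneq ne => ar; rewrite ar in ca *; apply/eqP/anc_root_eq.
by have := anc_dep (anc_up ca ne); have := rt_dep rt nr; lia.
Qed.

Lemma anc_antisym a c : anc a c -> anc c a -> a = c.
Proof. by move=> ac ca; apply: anc_dep_eq ac (anc_dep ca). Qed.

Lemma anc_total a c c' : anc c a -> anc c' a -> anc c c' || anc c' c.
Proof.
case/ancP=> i <- /ancP[j <-].
wlog le_ij : i j / i <= j.
  by move=> H; case/orP: (leq_total i j) => le; [|rewrite orbC]; apply: H.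
by rewrite -(subnK le_ij) iterD orbC (_ : anc _ _) //; apply/ancP; eexists.
Qed.

Lemma anc_parF c : c != r -> anc c (par c) = false.
Proof.
move=> nr; apply/negP => H.
by have := anc_antisym H (par_anc c) => E; have := par_neq nr; rewrite -E eqxx.
Qed.

Lemma child_toward m a : anc m a -> m != a ->
  exists c, [/\ c != r, par c = m & anc c a].
Proof.
move=> ma; elim/up_ind: ma => [|b nr nb mb IH _]; first by rewrite eqxx.
have [E|ne] := eqVneq m (par b); first by exists b; rewrite anc_refl.
have [c [cr pc cb]] := IH ne.
by exists c; split=> //; apply: anc_par.
Qed.

Lemma siblings_disjoint c c' a : c != r -> c' != r -> par c = par c' ->
  c != c' -> anc c a -> anc c' a = false.
Proof.
move=> nr nr' E ne ca; apply/negP => c'a.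
case/orP: (anc_total ca c'a) => H.
  by have := anc_up H ne; rewrite -E anc_parF.
by have := anc_up H; rewrite eq_sym ne E => /(_ isT); rewrite anc_parF.
Qed.

(** Climbing from [a] to the first ancestor [m] of [a'] gives the last common ancestor; [c] is its
    child on the side of [a]. *)
Lemma branching a a' : ~~ anc a a' ->
  exists m c, [/\ c != r, par c = m, anc c a, anc c a' = false & anc m a'].
Proof.
have := root_anc a.
have : anc r a' by apply: root_anc.
move=> ra' ra; elim/up_ind: ra => [|b nr _ rb IH nba'].
  by rewrite ra'.
have [pa|npa] := boolP (anc (par b) a').
  by exists (par b), b; split=> //; [apply: anc_refl | apply: negbTE].
have [m [c [cr pc ca ca' ma']]] := IH npa.
by exists m, c; split=> //; apply: anc_par.
Qed.

Lemma rooting_rel_par v : v != r -> t v (par v).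
Proof. by move=> nr; rewrite (rt_rel rt) nr eqxx. Qed.

Lemma rooting_sym : symmetric t.
Proof. by move=> x y; rewrite !(rt_rel rt) orbC. Qed.

Lemma rooting_connect x y : connect t x y.
Proof.
have H a : connect t a r.
  elim/up_ind: (root_anc a) => [|b nr _ _ IH]; first exact: connect0.
  by apply: connect_trans IH; apply: connect1; apply: rooting_rel_par.
apply: connect_trans (H x) _.
by rewrite (sym_connect_sym rooting_sym).
Qed.

(** By depth, two vertices cannot be parents of each other, so the disjunction may be counted as a
    sum. *)
Lemma rooting_split x y :
  t x y = ((x != r) && (par x == y)) + ((y != r) && (par y == x)) :> nat.
Proof.
rewrite (rt_rel rt).
have [_|nx] /= := eqVneq x r; first by rewrite add0n.
have [_|ny] /= := eqVneq y r; first by rewrite orbF addn0.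
case: (par x =P y) => [E|] //=; case: (par y =P x) => [E'|] //=.
by have := rt_dep rt nx; have := rt_dep rt ny; rewrite E E'; lia.
Qed.

Lemma rooting_sum_degree : \sum_v degree t v = 2 * #|T|.-1.
Proof.
under eq_bigr => v _ do
  (rewrite degreeE; under eq_bigr => w _ do rewrite rooting_split;
   rewrite big_split /=).
rewrite big_split /= [X in _ + X]exchange_big /= mul2n -addnn.
have H : \sum_i \sum_j ((i != r) && (par i == j)) = #|T|.-1.
  have -> : #|T|.-1 = \sum_i (i != r).
    by rewrite -(cardC1 r) -sum1_card big_mkcond.
  apply: eq_bigr => i _; case: (i != r) => /=; last by rewrite big1.
  rewrite (bigD1 (par i)) //= eqxx big1 ?addn0 // => j.
  by rewrite eq_sym => /negbTE->.
by rewrite H.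
Qed.

Lemma degree_rooted v : degree t v = (v != r) + #|[set c | (c != r) && (par c == v)]|.
Proof.
rewrite degreeE; under eq_bigr => w _ do rewrite rooting_split.
rewrite big_split /= cardsE -sum1_card [in RHS]big_mkcond /=; congr (_ + _).
case: (v != r) => /=; last by rewrite big1.
rewrite (bigD1 (par v)) //= eqxx big1 ?addn0 // => j.
by rewrite eq_sym => /negbTE->.
Qed.

End RootedTheory.

Lemma dep_adjacent t r par dep x y : rooting t r par dep -> t x y -> dep x <= (dep y).+1.
Proof.
move=> rt; rewrite (rt_rel rt) => /orP[/andP[xr /eqP <-]|/andP[yr /eqP <-]].
  by rewrite (rt_dep rt xr).
by rewrite (rt_dep rt yr); lia.
Qed.

(** The path from [a] to [c] survives in [t'], so the depths of its ends in [t'] differ by at most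
    its length. Depth thus serves as distance across exchanges. *)
Lemma dep_up t r par dep t' r' par' dep' c a :
  rooting t r par dep -> rooting t' r' par' dep' -> anc par c a ->
  (forall x, anc par c x -> anc par x a -> x != c -> t' x (par x)) ->
  dep' a + dep c <= dep' c + dep a /\ dep' c + dep c <= dep' a + dep a.
Proof.
move=> rt rt' ca; elim/(up_ind rt): ca => [|x xr xc cpx IH H]; first by [].
have [|le1 le2] := IH.
  by move=> z cz zx zc; apply: H => //; apply: anc_par.
have txp : t' x (par x) by apply: H => //; [apply: anc_par | apply: anc_refl].
have := dep_adjacent rt' txp; have := rt_dep rt xr.
by rewrite (rooting_sym rt') in txp; have := dep_adjacent rt' txp; lia.
Qed.

(** A breadth-first tree: [dep] is the distance from [r], and the parent is a neighbour one step
    nearer. *)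
Lemma exists_rooting t r : symmetric t -> irreflexive t ->
  (forall x y, connect t x y) ->
  exists t' par dep, [/\ subrel t' t & rooting t' r par dep].
Proof.
move=> st it ct.
pose walk n v := [exists p : n.-tuple T, path t r p && (last r p == v)].
have walkP n v : reflect (exists p, [/\ path t r p, last r p = v & size p = n]) (walk n v).
  apply: (iffP existsP) => [[p /andP[pp /eqP lp]]|[p [pp lp /eqP sp]]].
    by exists p; rewrite size_tuple.
  by exists (Tuple sp); rewrite /= pp lp eqxx.
have walk_ex v : exists n, walk n v.
  by have /connectP[p pp E] := ct r v; exists (size p); apply/walkP; exists p.
pose dep v := ex_minn (walk_ex v).
have depP v : walk (dep v) v by rewrite /dep; case: ex_minnP.
have dep_min v n : walk n v -> dep v <= n by rewrite /dep; case: ex_minnP => m _ H /H.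
(* For [v] other than [r], the last step of a shortest walk provides what [pick] looks for. *)
pose par v := if v == r then r
  else odflt r [pick w | t v w && ((dep w).+1 == dep v)].
have par_spec v : v != r -> t v (par v) /\ (dep (par v)).+1 = dep v.
  move=> nr; rewrite /par (negbTE nr); case: pickP => [w /andP[tw /eqP]//|].
  have [p [pp lp sp]] := walkP _ _ (depP v).
  case/lastP: p pp lp sp => [_ /= E|p x]; first by rewrite E eqxx in nr.
  rewrite rcons_path last_rcons size_rcons => /andP[pp tx] xv sp; subst x.
  have le1 : dep (last r p) <= size p by apply: dep_min; apply/walkP; exists p.
  have [q [pq lq sq]] := walkP _ _ (depP (last r p)).
  have le2 : dep v <= (size q).+1.
    rewrite -(size_rcons q v); apply: dep_min; apply/walkP.
    by exists (rcons q v); rewrite rcons_path last_rcons pq lq.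
  move/(_ (last r p)); rewrite st tx /= => /negP[]; apply/eqP; lia.
pose t' x y := ((x != r) && (par x == y)) || ((y != r) && (par y == x)).
exists t', par, dep; split.
  move=> x y /orP[] /andP[nr /eqP <-]; last rewrite st; exact: (par_spec _ nr).1.
split=> //; first by rewrite /par eqxx.
  by apply/eqP; rewrite -leqn0; apply: dep_min; apply/walkP; exists [::].
by move=> v /par_spec[].
Qed.

Lemma connected_degree_sum t : 0 < #|T| -> symmetric t -> irreflexive t ->
  (forall x y, connect t x y) -> 2 * #|T|.-1 <= \sum_v degree t v.
Proof.
case/card_gt0P=> r _ st it ct.
have [t' [par [dep [sub rt]]]] := exists_rooting r st it ct.
rewrite -(rooting_sum_degree rt); apply: leq_sum => v _.
by apply: subset_leq_card; apply/subsetP => w; rewrite !inE; apply: sub.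
Qed.

(** The breadth-first tree inside [t] already has degree sum [2 * #|T|.-1], so [t] has no further
    edge. *)
Lemma tree_rooting t r : symmetric t -> irreflexive t ->
  (forall x y, connect t x y) -> \sum_v degree t v <= 2 * #|T|.-1 ->
  exists par dep, rooting t r par dep.
Proof.
move=> st it ct le.
have [t' [par [dep [sub rt]]]] := exists_rooting r st it ct.
exists par, dep; have [rt1 rt2 rt3 rt4] := rt; constructor=> // x y; rewrite -rt4.
have sub_nbr v : [set w | t' v w] \subset [set w | t v w].
  by apply/subsetP => w; rewrite !inE; apply: sub.
have E := @eq_leq_sum _ (degree t') (degree t) (fun v => subset_leq_card (sub_nbr v)).
have /(_ _ x) := E; rewrite (rooting_sum_degree rt) => /(_ le) Ex.
have /eqP/setP/(_ y) : [set w | t' x w] == [set w | t x w].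
  by rewrite eqEcard sub_nbr; move: Ex; rewrite /degree => ->; rewrite leqnn.
by rewrite !inE.
Qed.

(** A deepest vertex of a cycle has its parent as both cyclic neighbours, which forces length at
    most 2. *)
Lemma rooting_acyclic t r par dep : rooting t r par dep -> acyclic_graph t.
Proof.
move=> rt c sz /andP[cc uc].
have [x0 x0c] : exists x, x \in c by case: c sz {cc uc} => // x c; exists x; rewrite inE eqxx.
case: (@arg_maxnP _ x0 (mem c) dep x0c) => x xc xmax.
have nbr y : y \in c -> t x y -> x != r /\ par x = y.
  move=> yc; rewrite (rt_rel rt) => /orP[/andP[nx /eqP//]|/andP[ny /eqP E]].
  by have := xmax _ yc; rewrite /= (rt_dep rt ny) E ltnn.
have xn : next c x = par x.
  by have [] := nbr (next c x); rewrite ?mem_next //; apply: next_cycle.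
have xp : prev c x = par x.
  have [] := nbr (prev c x); rewrite ?mem_prev //.
  by rewrite (rooting_sym rt); apply: prev_cycle.
have nn : next c (next c x) = x by rewrite xn -xp next_prev.
have [i [s E]] : exists i s, rot i c = x :: s by have [i s E] := rot_to xc; exists i, s.
have: next (rot i c) (next (rot i c) x) = x by rewrite !next_rot.
rewrite E.
have := uc; rewrite -(rot_uniq i) E.
have : 2 < size (x :: s) by rewrite -E size_rot.
case: s {E} => [|y [|z s]] //= _; rewrite !inE !negb_or !eqxx.
case/and3P=> /and3P[xy xz xs] /andP[yz ys] _.
by rewrite eq_sym (negbTE xy) => E; rewrite E eqxx in xz.
Qed.

End Rooted.

(** * Edge exchanges *)

Section Swap.

Variables (T : finType) (e : rel T).
Hypotheses (e_sym : symmetric e) (e_irr : irreflexive e).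

(** Spanning trees as connected subgraphs with the right number of edges: after an exchange this is
    checked by counting, without an argument about cycles. *)
Definition stree (t : rel T) : Prop :=
  [/\ symmetric t, subrel t e, forall x y, connect t x y
    & \sum_v degree t v = 2 * #|T|.-1].

Lemma stree_rooting t r : stree t -> exists par dep, rooting t r par dep.
Proof.
case=> st sub ct sumt; apply: tree_rooting => //; last by rewrite sumt.
by move=> x; apply/negP => /sub; rewrite e_irr.
Qed.

Lemma stree_spanning_tree t : 0 < #|T| -> stree t -> spanning_tree e t.
Proof.
move=> /[dup] /card_gt0P[r _] T_gt0 st; case: (st) => symt sub ct _.
have [par [dep rt]] := stree_rooting r st.
split=> //; split; [split=> // | by [] | exact: rooting_acyclic rt].
by move=> x; apply/negP => /sub; rewrite e_irr.
Qed.

Lemma exists_stree : connected_graph e -> exists t, stree t.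
Proof.
case=> /card_gt0P[r _] ct.
have [t [par [dep [sub rt]]]] := exists_rooting r e_sym e_irr ct.
exists t; split=> //; first exact: rooting_sym rt.
  by move=> x y; apply: rooting_connect rt _ _.
exact: rooting_sum_degree rt.
Qed.

Lemma stree_degree_gt0 t v : 1 < #|T| -> stree t -> 0 < degree t v.
Proof.
move=> T_gt1 st; have [par [dep rt]] := stree_rooting v st.
have [w wv] : exists w, w != v.
  apply/existsP; apply: contraLR T_gt1 => /existsPn H.
  rewrite -leqNgt -(card1 v) subset_leq_card //.
  by apply/subsetP => w _; rewrite inE -[_ == _]negbK.
rewrite eq_sym in wv.
have [c [cr pc _]] := child_toward rt (root_anc rt w) wv.
apply/card_gt0P; exists c; rewrite inE (rooting_sym rt) -pc.
by have := rooting_rel_par rt cr.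
Qed.

(* Each [c] in [D] stands for the tree edge from [c] to its parent. *)
Definition swap (t : rel T) par (D : seq T) (A : seq (T * T)) : rel T :=
  fun x y => [|| t x y && ~~ ((x \in D) && (par x == y) || (y \in D) && (par y == x)),
                 (x, y) \in A | (y, x) \in A].

(** For explicit lists these unfold to sums of equality indicators, so degrees after an exchange
    become linear arithmetic. *)
Definition removed_at par (D : seq T) v :=
  foldr (fun c n => (c == v) + (par c == v) + n) 0 D.
Definition added_at (A : seq (T * T)) v :=
  foldr (fun p n => (p.1 == v) + (p.2 == v) + n) 0 A.

Lemma removed_atE par D v :
  removed_at par D v = \sum_(c <- D) ((c == v) + (par c == v)).
Proof. by elim: D => [|c D IH]; rewrite ?big_nil // big_cons /= IH. Qed.

Section SwapTheory.

Variables (t : rel T) (r : T) (par : T -> T) (dep : T -> nat).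
Hypotheses (tt : stree t) (rt : rooting t r par dep).
Variables (D : seq T) (A : seq (T * T)).
Local Notation t' := (swap t par D A).

Lemma swap_sym : symmetric t'.
Proof.
move=> x y; rewrite /swap (rooting_sym rt) orbC -orbA [in RHS]orbCA orbC.
by rewrite -!orbA; do 2!congr (_ || _); rewrite [(x \in D) && _ || _]orbC.
Qed.

(** Only an inequality, since an added pair may already be an edge or be listed twice. *)
Lemma swap_degree_le v : uniq D -> r \notin D ->
  degree t' v + removed_at par D v <= degree t v + added_at A v.
Proof.
move=> uD rD.
have remE : removed_at par D v =
    \sum_w (((v \in D) && (par v == w)) + ((w \in D) && (par w == v))).
  rewrite removed_atE !big_split /=; congr (_ + _).
    rewrite big_uniq //=; case: (boolP (v \in D)) => vD /=; last first.
      by rewrite !big1 // => c cD; case: eqP cD vD => // -> ->.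
    transitivity 1.
      by rewrite (bigD1 v) //= eqxx big1 // => w /andP[_ /negbTE->].
    rewrite (bigD1 (par v)) //= eqxx big1 // => w.
    by rewrite eq_sym => /negbTE->.
  by rewrite big_uniq //= big_mkcond; apply: eq_bigr => w _; case: (w \in D).
have addE : \sum_w (((v, w) \in A) + ((w, v) \in A)) <= added_at A v.
  elim: A => [|[a b] A' IH] /=; first by rewrite big1.
  apply: leq_trans (leq_add (leqnn _) IH).
  rewrite addnC -leq_subLR -sumnB; last first.
    by move=> w _; rewrite !inE; do 2!case: (_ \in A'); rewrite ?orbT; lia.
  apply: (@leq_trans (\sum_w ((a == v) * (b == w) + (b == v) * (a == w)))).
    apply: leq_sum => w _; rewrite !inE !xpair_eqE [v == a]eq_sym [v == b]eq_sym.
    rewrite [w == a]eq_sym [w == b]eq_sym.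
    by do 4!case: (_ == _); do 2!case: (_ \in A').
  rewrite big_split /= -!big_distrr /=.
  have one x : \sum_w (x == w) = 1.
    by rewrite (bigD1 x) //= eqxx big1 // => w; rewrite eq_sym => /negbTE->.
  by rewrite !one !muln1.
rewrite !degreeE remE -big_split /=.
apply: leq_trans (leq_add (leqnn _) addE); rewrite -big_split /=.
apply: leq_sum => w _; rewrite (rooting_split rt) /swap (rt_rel rt).
have vr : (v \in D) ==> (v != r) by apply/implyP => vD; apply: contraNneq rD => <-.
have wr : (w \in D) ==> (w != r) by apply/implyP => vD; apply: contraNneq rD => <-.
move: vr wr; move: (v \in D) (w \in D) (v != r) (w != r) (par v == w) (par w == v).
by do 6!case=> //=; do 2!case: (_ \in A).
Qed.

Lemma swap_keep a : a != r -> a \notin D -> t' a (par a).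
Proof.
move=> ar aD; rewrite /swap (rooting_rel_par rt ar) (negbTE aD) /= negb_and.
suff -> : par (par a) != a by rewrite orbT.
apply/eqP => E; have := rt_dep rt ar; have := dep_par rt (par a).
by rewrite E; lia.
Qed.

(** The condition on [D] says that no removed edge lies between [a] and [c]. *)
Lemma swap_connect_up c a : anc par c a ->
  all (fun c' => anc par c' a ==> anc par c' c) D -> connect t' a c.
Proof.
move=> ca; elim/(up_ind rt): ca => [|b nr nbc cb IH /allP aD]; first by rewrite connect0.
apply: connect_trans (IH _); last first.
  apply/allP => c' c'D; apply/implyP => H.
  by have /implyP-> // := aD _ c'D; apply: anc_par.
apply/connect1/swap_keep => //; apply/negP => /aD; rewrite anc_refl /= => bc.
by rewrite (anc_antisym rt bc (anc_par cb)) eqxx in nbc.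
Qed.

Lemma swap_added a b : (a, b) \in A -> connect t' a b.
Proof. by move=> H; apply: connect1; rewrite /swap H orbT. Qed.

Lemma swap_connect_sym x y : connect t' x y = connect t' y x.
Proof. exact: (sym_connect_sym swap_sym). Qed.

(** If the lower end of each removed edge still reaches the root, every vertex does. Connectedness
    bounds the number of edges from below and [swap_degree_le] from above, so the result is a tree
    and the degree inequalities are equations. *)
Lemma swap_stree : uniq D -> r \notin D -> size A = size D ->
  all (fun p => e p.1 p.2) A -> all (fun c => connect t' c r) D ->
  stree t' /\
  forall v, degree t' v + removed_at par D v = degree t v + added_at A v.
Proof.
move=> uD rD sz /allP Ae /allP Dr.
have sub : subrel t' e.
  case: tt => _ sub _ _ x y /or3P[/andP[/sub]|/Ae|/Ae] //=.
  by rewrite e_sym.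
have toR a : connect t' a r.
  elim/(up_ind rt): (root_anc rt a) => [|b nr _ _ IH]; first exact: connect0.
  have [bD|bD] := boolP (b \in D); first exact: Dr.
  by apply: connect_trans IH; apply/connect1/swap_keep.
have ct x y : connect t' x y.
  by apply: connect_trans (toR x) _; rewrite swap_connect_sym.
have irr : irreflexive t' by move=> x; apply/negP => /sub; rewrite e_irr.
have T_gt0 : 0 < #|T| by apply/card_gt0P; exists r.
have lo := connected_degree_sum T_gt0 swap_sym irr ct.
have one x : \sum_w (x == w) = 1.
  by rewrite (bigD1 x) //= eqxx big1 // => w; rewrite eq_sym => /negbTE->.
have sumD : \sum_v removed_at par D v = 2 * size D.
  elim: (D) => [|c D' IH] /=; first by rewrite big1.
  by rewrite !big_split /= IH !one; lia.
have sumA : \sum_v added_at A v = 2 * size A.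
  elim: (A) => [|c D' IH] /=; first by rewrite big1.
  by rewrite !big_split /= IH !one; lia.
have E := @eq_leq_sum _ (fun v => degree t' v + removed_at par D v)
  (fun v => degree t v + added_at A v) (fun v => swap_degree_le v uD rD).
case: tt => _ _ _ sumt.
have {}E : forall v, degree t' v + removed_at par D v = degree t v + added_at A v.
  by apply: E; rewrite !big_split /= sumD sumA sumt sz; lia.
split=> //; split=> //; first exact: swap_sym.
have : \sum_v (degree t' v + removed_at par D v) = \sum_v (degree t v + added_at A v).
  by apply: eq_bigr => v _.
by rewrite !big_split /= sumD sumA sumt sz => /addIn.
Qed.

End SwapTheory.
End Swap.

(** * Trees with the fewest leaves *)

Lemma claw_free_adjacent (T : finType) (e : rel T) :
  simple_graph e -> claw_free e -> forall x a b c, e x a -> e x b -> e x c ->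
  a != b -> a != c -> b != c -> [|| e a b, e a c | e b c].
Proof.
case=> e_sym e_irr cf x a b c xa xb xc ab ac bc.
apply/negPn/negP; rewrite !negb_or => /and3P[nab nac nbc]; apply: cf.
have xneq y : e x y -> x != y by apply: contraTneq => <-; rewrite e_irr.
pose g (i : 'I_3) := tnth [tuple a; b; c] i.
exists (fun z => match z with inl _ => x | inr i => g i end).
have gE i : [\/ g i = a /\ i = 0 :> nat, g i = b /\ i = 1 :> nat
              | g i = c /\ i = 2 :> nat].
  case: i => [[|[|[|i]]] lt_i3] //;
    [apply: Or31 | apply: Or32 | apply: Or33]; split=> //; exact: tnth_nth a _ _.
have xg i : e x (g i) by case: (gE i) => -[-> _].
have gg i j : e (g i) (g j) = false.
  by case: (gE i) => -[-> _]; case: (gE j) => -[-> _];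
    rewrite ?e_irr //; apply: negbTE; rewrite // e_sym.
split=> [[i|i] [j|j] /= E|[i|i] [j|j] /=].
- by rewrite [i]ord1 [j]ord1.
- by have := xneq _ (xg j); rewrite E eqxx.
- by have := xneq _ (xg i); rewrite E eqxx.
- congr inr; apply: val_inj => /=; move: E ab ac bc.
  by case: (gE i) => -[-> ->]; case: (gE j) => -[-> ->] // ->; rewrite eqxx.
- exact: e_irr.
- exact: xg.
- by rewrite e_sym xg.
- exact: gg.
Qed.

Lemma sum_indicator (T : finType) (A : {set T}) : \sum_v (v \in A) = #|A|.
Proof. by rewrite -sum1_card [RHS]big_mkcond. Qed.

Definition leaves (T : finType) (t : rel T) : {set T} := [set v | degree t v == 1].

(** Replaces each indicator [x == a] by an unknown number at most 1; relations between indicators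
    must be in the goal beforehand. *)
Ltac lia_at a :=
  try match goal with H : is_true (0 < degree _ a) |- _ => move: H end;
  repeat match goal with
  | |- context [nat_of_bool (?x == a)] =>
      let n := fresh "n" in
      have := leq_b1 (x == a); set n := nat_of_bool (x == a); clearbody n
  end; clear; lia.

Ltac by_anc :=
  rewrite /=; repeat match goal with
  | H : is_true (anc ?p ?x ?y) |- context [anc ?p ?x ?y] => rewrite H
  | H : anc ?p ?x ?y = false |- context [anc ?p ?x ?y] => rewrite H
  end; rewrite ?anc_refl ?implybT //.

Ltac neqs :=
  rewrite /= ?inE ?negb_or ?eqxx; repeat match goal with
  | H : is_true (?x != ?y) |- context [?x == ?y] => rewrite (negbTE H)
  | H : is_true (?x != ?y) |- context [?y == ?x] => rewrite [y == x]eq_sym (negbTE H)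
  end.
Ltac by_neq := neqs; done.

(** Routes in an exchanged tree: [up] and [down] follow kept tree edges, [edge] uses an added
    one. *)
Ltac via x := apply: (@connect_trans _ _ x).
Ltac up := match goal with rt : rooting _ _ _ _ |- _ =>
  rewrite ?(swap_connect_up rt) ?(root_anc rt) //; by_anc end.
Ltac down := match goal with rt : rooting _ _ _ _ |- _ =>
  rewrite (swap_connect_sym rt); up end.
Ltac edge := first
  [ apply: swap_added; by rewrite !inE !eqxx ?orbT
  | match goal with rt : rooting _ _ _ _ |- _ => rewrite (swap_connect_sym rt) end;
    apply: swap_added; by rewrite !inE !eqxx ?orbT ].

Section FewestLeaves.

Variables (T : finType) (e : rel T) (l : nat).
Hypotheses (e_sym : symmetric e) (e_irr : irreflexive e).
Hypothesis claw : forall x a b c, e x a -> e x b -> e x c ->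
  a != b -> a != c -> b != c -> [|| e a b, e a c | e b c].
Hypothesis l_min : forall t, stree e t -> l <= #|leaves t|.
Hypothesis l_ge3 : 2 < l.

(** Minimality of [l] turns the bound into equality, while an exchange only has to be shown not to
    add leaves. *)
Definition good t := stree e t /\ #|leaves t| <= l.

Lemma good_card t : good t -> #|leaves t| = l.
Proof. by case=> /l_min le ge; apply/eqP; rewrite eqn_leq ge. Qed.

Lemma good_leaf t : good t -> exists u, degree t u = 1.
Proof.
move=> /good_card E; have /card_gt0P[u] : 0 < #|leaves t| by lia.
by rewrite inE => /eqP; exists u.
Qed.

Lemma good_degree_gt0 t v : good t -> 0 < degree t v.
Proof.
move=> gt; have T_gt1 : 1 < #|T|.
  by apply: leq_trans (max_card (leaves t)); rewrite good_card //; lia.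
by apply: stree_degree_gt0 gt.1.
Qed.

(** With all degrees at most 2, the degree sum of a tree leaves room for only two leaves. *)
Lemma good_branch t : good t -> exists r, 2 < degree t r.
Proof.
move=> gt; apply/existsP; apply: contraT => /existsPn no.
have [_ _ _ sumt] := gt.1.
have: \sum_v (degree t v + (v \in leaves t)) <= \sum_(v : T) 2.
  apply: leq_sum => v _; have := no v; rewrite inE.
  by have := good_degree_gt0 v gt; case: eqP; lia.
have -> : \sum_(v : T) 2 = #|T| * 2 by rewrite sum_nat_const.
rewrite big_split /= sumt.
rewrite sum_indicator good_card //.
have le : #|leaves t| <= #|T| := max_card _.
rewrite good_card // in le; case: #|T| le => [|N] /=; lia.
Qed.

(** Brings a bound at a fixed vertex [b] into the indicator arithmetic at an arbitrary vertex
    [a]. *)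
Lemma degree_at (t : rel T) b a n : n <= degree t b -> n * (b == a) <= degree t a.
Proof. by case: eqP => [->|] /=; rewrite ?muln1 ?muln0. Qed.

Lemma neq_at (x y a : T) : x != y -> (x == a) + (y == a) <= 1.
Proof.
move=> ne; case: (x =P a) => [<-|_]; last by case: (_ == _).
by rewrite eq_sym (negbTE ne).
Qed.

(** * Leaf counts after an exchange *)

Section Exchange.

Variables (t : rel T) (r : T) (par : T -> T) (dep : T -> nat).
Hypotheses (gt : good t) (rt : rooting t r par dep).

(** The last hypothesis says, through the degree equation, that all leaves of the new tree lie in
    [S]. *)
Lemma swap_leaves D A (S : {set T}) : uniq D -> r \notin D -> size A = size D ->
  all (fun p => e p.1 p.2) A -> all (fun c => connect (swap t par D A) c r) D ->
  (forall a, 0 < degree t a -> 1 + removed_at par D a = degree t a + added_at A a ->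
    a \in S) ->
  [/\ stree e (swap t par D A), #|leaves (swap t par D A)| <= #|S|
    & forall v, degree (swap t par D A) v + removed_at par D v = degree t v + added_at A v].
Proof.
move=> uD rD sz Ae Dr H.
have [st' E] := swap_stree e_sym e_irr gt.1 rt uD rD sz Ae Dr.
split=> //; apply/subset_leq_card/subsetP => a; rewrite inE => /eqP da.
by apply: H (good_degree_gt0 a gt) _; rewrite -E da.
Qed.

(** The leaf [u] is traded for at most one new leaf [c]. Taking [c] equal to [u] covers exchanges
    that create no leaf. *)
Lemma swap_good D A u c : degree t u = 1 ->
  uniq D -> r \notin D -> size A = size D ->
  all (fun p => e p.1 p.2) A -> all (fun c => connect (swap t par D A) c r) D ->
  (forall a, 0 < degree t a -> 1 + removed_at par D a = degree t a + added_at A a ->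
    (c == a) = 0 :> nat -> degree t a + (u == a) <= 1) ->
  good (swap t par D A) /\
  forall v, degree (swap t par D A) v + removed_at par D v = degree t v + added_at A v.
Proof.
move=> u1 uD rD sz Ae Dr H.
have [|st' le E] := @swap_leaves D A (c |: leaves t :\ u) uD rD sz Ae Dr.
  move=> a a0 /(H a a0); rewrite !inE ![a == _]eq_sym.
  by case: (c == a) => //= /(_ erefl); case: (u == a) => /=; lia_at a.
split=> //; split=> //; apply: leq_trans le _; apply: leq_trans (leq_card_setU _ _) _.
have := cardsD1 u (leaves t); rewrite inE u1 eqxx cards1 /=.
by have := gt.2; lia.
Qed.

(** A leaf is lost and none is gained, against the minimality of [l]. *)
Lemma swap_absurd D A u : degree t u = 1 ->
  uniq D -> r \notin D -> size A = size D ->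
  all (fun p => e p.1 p.2) A -> all (fun c => connect (swap t par D A) c r) D ->
  (forall a, 0 < degree t a -> 1 + removed_at par D a = degree t a + added_at A a ->
    degree t a + (u == a) <= 1) -> False.
Proof.
move=> u1 uD rD sz Ae Dr H.
have [|st' le E] := @swap_leaves D A (leaves t :\ u) uD rD sz Ae Dr.
  move=> a a0 /(H a a0); rewrite !inE ![a == _]eq_sym.
  by case: (u == a) => /=; lia_at a.
have := cardsD1 u (leaves t); rewrite inE u1 eqxx /=.
by have := gt.2; have := l_min st'; lia.
Qed.

(** Two leaves are lost and only [c] may be gained. *)
Lemma swap_absurd2 D A u u' c : degree t u = 1 -> degree t u' = 1 -> u != u' ->
  uniq D -> r \notin D -> size A = size D ->
  all (fun p => e p.1 p.2) A -> all (fun c => connect (swap t par D A) c r) D ->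
  (forall a, 0 < degree t a -> 1 + removed_at par D a = degree t a + added_at A a ->
    (c == a) = 0 :> nat -> degree t a + (u == a) + (u' == a) <= 1) -> False.
Proof.
move=> u1 u1' uu' uD rD sz Ae Dr H.
have [|st' le E] := @swap_leaves D A (c |: leaves t :\ u :\ u') uD rD sz Ae Dr.
  move=> a a0 /(H a a0); rewrite !inE ![a == _]eq_sym.
  case: (c == a) => //= /(_ erefl).
  by case: (u == a); case: (u' == a) => /=; lia_at a.
have := cardsD1 u (leaves t); have := cardsD1 u' (leaves t :\ u).
rewrite !inE u1 u1' eqxx eq_sym uu' /=.
have := (leq_card_setU [set c] (leaves t :\ u :\ u')).1; rewrite cards1.
by have := gt.2; have := l_min st'; lia.
Qed.

Lemma child_degree c m : c != r -> par c = m -> (m != r) < degree t m.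
Proof.
move=> cr pc; rewrite (degree_rooted rt) -[ltnLHS]addn0 ltn_add2l.
by apply/card_gt0P; exists c; rewrite inE cr pc eqxx.
Qed.

Lemma children_degree c c' m : c != r -> c' != r -> par c = m -> par c' = m ->
  c != c' -> (m != r) + 2 <= degree t m.
Proof.
move=> cr cr' pc pc' ne; rewrite (degree_rooted rt) leq_add2l.
rewrite (_ : 2 = #|[set c; c']|); last by rewrite cards2 ne.
by apply/subset_leq_card/subsetP => x; rewrite !inE => /orP[]/eqP->;
  rewrite ?cr ?cr' ?pc ?pc' eqxx.
Qed.

Hypothesis r_branch : 2 < degree t r.

Lemma leaf_neq_root u : degree t u = 1 -> u != r.
Proof. by move=> u1; apply: contraTneq r_branch => <-; rewrite u1. Qed.

Lemma parent_degree_gt1 c : c != r -> 1 < degree t (par c).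
Proof.
move=> cr; have := child_degree cr erefl.
by have [-> _|_] := eqVneq (par c) r; first exact: ltnW.
Qed.

Lemma leaf_anc u a : degree t u = 1 -> anc par u a = (u == a).
Proof.
move=> u1; apply/idP/eqP => [ua|->]; last exact: anc_refl.
have [//|/(child_toward rt ua)[c [cr pc _]]] := eqVneq u a.
by have := parent_degree_gt1 cr; rewrite pc u1.
Qed.

Lemma inner_not_leaf m a : anc par m a -> m != a -> 1 < degree t m.
Proof.
move=> ma ne; have [c [cr <- _]] := child_toward rt ma ne.
exact: parent_degree_gt1.
Qed.

(** The last common ancestor [m] of [u] and [v] lies properly above both, so it has two children,
    and also a parent unless it is the root, which is a branch vertex. *)
Lemma branching_leaf u v : degree t u = 1 -> u != v -> ~~ anc par v u ->
  exists m c, [/\ c != r, par c = m, anc par c u, anc par c v = false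
    & [/\ anc par m v, m != v, anc par m u, m != u & 2 < degree t m]].
Proof.
move=> u1 uv nvu.
have nuv : ~~ anc par u v by rewrite leaf_anc.
have [m [c [cr pc cu cv mv]]] := branching rt nuv.
have mu : anc par m u by rewrite -pc; apply: anc_trans (par_anc _ _) cu.
have nmv : m != v by apply: contraNneq nvu => <-.
have nmu : m != u by apply: contraTneq (parent_degree_gt1 cr) => E; rewrite pc E u1.
exists m, c; split=> //; split=> //.
have [c' [cr' pc' cv']] := child_toward rt mv nmv.
have cc' : c != c' by apply: contraTneq cv' => <-; rewrite cv.
have := children_degree cr cr' pc pc' cc'.
by have [->|_] := eqVneq m r => //; apply.
Qed.

End Exchange.

(** Joining two adjacent leaves and cutting below the branch vertex where their paths to the root
    meet loses two leaves and creates at most one. *)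
Lemma leaves_independent t u u' : good t -> degree t u = 1 -> degree t u' = 1 ->
  e u u' = false.
Proof.
move=> gt u1 u1'; apply/negP => uu'.
have [r r3] := good_branch gt.
have [par [dep rt]] := stree_rooting e_irr r gt.1.
have ne : u != u' by apply: contraTneq uu' => ->; rewrite e_irr.
have [|m [c [cr pc cu cu' [mu' nmu' mu nmu m3]]]] := branching_leaf rt r3 u1 ne.
  by rewrite (leaf_anc rt) // eq_sym.
apply: (@swap_absurd2 t r par dep gt rt [:: c] [:: (u, u')] u u' c) => //=.
- by rewrite inE eq_sym.
- by rewrite uu'.
- rewrite andbT; set t' := swap _ _ _ _.
  have cuu : connect t' c u.
    by rewrite (swap_connect_sym rt); apply: (swap_connect_up rt) => //; by_anc.
  apply: connect_trans cuu _; apply: (@connect_trans _ _ u').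
    by apply: swap_added; rewrite inE.
  by apply: (swap_connect_up rt); [apply: root_anc rt _ | by_anc].
- move=> a a0; rewrite pc.
  by have := degree_at a m3; lia_at a.
Qed.

(** * Leaf neighbours in a tree rooted at a branch vertex *)

Section BranchRoot.

Variables (t : rel T) (r : T) (par : T -> T) (dep : T -> nat).
Hypotheses (gt : good t) (rt : rooting t r par dep) (r_branch : 2 < degree t r).
Local Notation anc := (anc par).
Local Notation leaf u := (degree t u = 1).

(** The edge above [v] is replaced by [v u], and the parent of [v] becomes a leaf in place of
    [u]. *)
Lemma swap_to_outer_leaf u v : leaf u -> e v u -> v != r -> anc v u = false ->
  degree t (par v) = 2 ->
  let t' := swap t par [:: v] [:: (u, v)] in
  good t' /\
  forall a, degree t' a + ((v == a) + (par v == a)) = degree t a + ((u == a) + (v == a)).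
Proof.
move=> u1 vu nr nvu q2; set q := par v in q2 *.
have := @swap_good t r par dep gt rt [:: v] [:: (u, v)] u q u1.
case=> //=.
- by rewrite inE eq_sym.
- by rewrite e_sym vu.
- rewrite andbT; apply: (@connect_trans _ _ u).
    by rewrite (swap_connect_sym rt); apply: swap_added; rewrite inE.
  by apply: (swap_connect_up rt); [apply: root_anc rt _ | by_anc].
- by move=> a a0; rewrite -/q; have := degree_at a (eq_leq (esym q2)); lia_at a.
- by move=> gt' E; split=> // a; have := E a; rewrite -/q !addn0.
Qed.

(** A parent of degree at least 3 would not become a leaf, so the same exchange would lose the leaf
    [u] for nothing. *)
Lemma outer_leaf_parent u v : leaf u -> e v u -> v != r -> anc v u = false ->
  degree t (par v) = 2.
Proof.
move=> u1 vu nr nvu; have q_gt1 := parent_degree_gt1 rt r_branch nr.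
apply/eqP; rewrite eqn_leq q_gt1 andbT leqNgt; apply/negP => q3.
apply: (@swap_absurd t r par dep gt rt [:: v] [:: (u, v)] u) => //=.
- by rewrite inE eq_sym.
- by rewrite e_sym vu.
- rewrite andbT; apply: (@connect_trans _ _ u).
    by rewrite (swap_connect_sym rt); apply: swap_added; rewrite inE.
  by apply: (swap_connect_up rt); [apply: root_anc rt _ | by_anc].
- by move=> a a0; have := degree_at a q3; lia_at a.
Qed.

(** After the exchange both [par v] and [u'] are leaves. *)
Lemma outer_leaf_parent_nbr u u' v : leaf u -> leaf u' -> u != u' ->
  e v u -> v != r -> anc v u = false -> e (par v) u' = false.
Proof.
move=> u1 u1' ne vu nr nvu; have q2 := outer_leaf_parent u1 vu nr nvu.
have [gt' E] := swap_to_outer_leaf u1 vu nr nvu q2.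
apply: (leaves_independent gt').
  have := E (par v); rewrite q2 eqxx.
  have -> : u == par v = false by apply: contraPF u1 => /eqP->; rewrite q2.
  by lia_at (par v).
have := E u'; rewrite u1' (negbTE ne).
have -> : par v == u' = false by apply: contraPF u1' => /eqP<-; rewrite q2.
by lia_at u'.
Qed.

Lemma swap_inner_connect u v c : c != r -> par c = v -> anc c u ->
  all (fun c => connect (swap t par [:: c] [:: (u, v)]) c r) [:: c].
Proof.
move=> cr pc cu; rewrite /= andbT.
apply: (@connect_trans _ _ u).
  by rewrite (swap_connect_sym rt); apply: (swap_connect_up rt) => //; by_anc.
apply: (@connect_trans _ _ v); first by apply: swap_added; rewrite inE.
apply: (swap_connect_up rt); first exact: root_anc rt _.
by rewrite /= -pc (anc_parF rt cr).
Qed.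

Lemma inner_leaf_child u v c : leaf u -> e v u -> c != r -> par c = v -> anc c u ->
  degree t c <= 2.
Proof.
move=> u1 vu cr pc cu; rewrite leqNgt; apply/negP => c3.
apply: (@swap_absurd t r par dep gt rt [:: c] [:: (u, v)] u) => //=.
- by rewrite inE eq_sym.
- by rewrite e_sym vu.
- by have := swap_inner_connect cr pc cu.
- by move=> a a0; rewrite pc; have := degree_at a c3; lia_at a.
Qed.

(** Unless [c] is [u] itself, replacing the edge [c v] by [u v] makes [c] a leaf, and leaves are
    independent. *)
Lemma inner_leaf_child_nbr u u' v c : leaf u -> leaf u' -> u != u' ->
  e v u -> c != r -> par c = v -> anc c u -> e c u' = false.
Proof.
move=> u1 u1' ne vu cr pc cu.
have [<-|ncu] := eqVneq u c; first exact: leaves_independent gt u1 u1'.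
have c2 : degree t c = 2.
  apply/eqP; rewrite eqn_leq (inner_leaf_child u1 vu cr pc cu).
  by apply: inner_not_leaf rt r_branch _ _ cu _; rewrite eq_sym.
have [] := @swap_good t r par dep gt rt [:: c] [:: (u, v)] u c u1 => //=.
- by rewrite inE eq_sym.
- by rewrite e_sym vu.
- by have := swap_inner_connect cr pc cu.
- by move=> a a0; rewrite pc; have := degree_at a (eq_leq (esym c2)); lia_at a.
move=> gt' E; apply: (leaves_independent gt').
  by have := E c; rewrite pc c2 eqxx (negbTE ncu); lia_at c.
have := E u'; rewrite pc u1' (negbTE ne).
have -> : c == u' = false by apply: contraPF u1' => /eqP<-; rewrite c2.
by lia_at u'.
Qed.

(** Two such leaves and a neighbour [z] of [v] adjacent to neither would form a claw at [v]; it
    remains to find [z]. *)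
Lemma inner_leaf_unique v u u' : leaf u -> leaf u' -> 1 < degree t v ->
  e v u -> e v u' -> anc v u -> anc v u' -> u = u'.
Proof.
move=> u1 u1' v2 vu vu' au au'; apply/eqP; case: (boolP (u == u')) => // ne.
have leafF x : leaf x -> v != x by move=> x1; apply: contraTneq v2 => ->; rewrite x1.
have [c [cr pc cu]] := child_toward rt au (leafF _ u1).
have [c' [cr' pc' cu']] := child_toward rt au' (leafF _ u1').
have uu' := leaves_independent gt u1 u1'.
have ne' : u' != u by rewrite eq_sym.
have vc a : a != r -> par a = v -> e v a.
  by case: gt => -[_ sub _ _] _ ar <-; rewrite e_sym; apply/sub/(rooting_rel_par rt).
suff: False by [].
have key z : e v z -> z != u -> z != u' -> e z u = false -> e z u' = false -> False.
  by move=> vz zu zu' e1 e2; have := claw vz vu vu' zu zu' ne; rewrite e1 e2 uu'.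
(* If both leaves are below one child of [v], that child serves as [z]. *)
have [cc'|cc'] := eqVneq c c'.
  subst c'; apply: (key c) => //; first exact: vc.
  - by apply: contraTneq cu' => ->; rewrite (leaf_anc rt).
  - by apply: contraTneq cu => ->; rewrite (leaf_anc rt).
  - exact: inner_leaf_child_nbr u1' u1 ne' vu' cr pc cu'.
  - exact: inner_leaf_child_nbr u1 u1' ne vu cr pc cu.
have d3 := children_degree rt cr cr' pc pc' cc'.
(* With different children and [v] not the root, the parent of [v] serves: a leaf below [v] adjacent
   to it would force [v] to have degree at most 2. *)
have [vr|vr] := eqVneq v r; last first.
  have pv := rooting_rel_par rt vr; rewrite vr /= in d3.
  have p2 := parent_degree_gt1 rt r_branch vr.
  have H x : leaf x -> e v x -> anc v x -> e (par v) x = false.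
    move=> x1 vx vax; apply/negP => px.
    by have := inner_leaf_child x1 px vr erefl vax; move: d3; clear; lia.
  apply: (key (par v)); rewrite ?H //; first by case: gt => -[_ sub _ _] _; apply: sub.
  - by apply: contraTneq p2 => ->; rewrite u1.
  - by apply: contraTneq p2 => ->; rewrite u1'.
(* At the root a third child serves: its adjacency to either leaf would force the root to have
   degree 2. *)
have [z [zr pz zc zc']] : exists z, [/\ z != r, par z = v, z != c & z != c'].
  have: 0 < #|[set z | (z != r) && (par z == v)] :\ c :\ c'|.
    set S := [set z | _]; have v3 : 2 < #|S|.
      have v3 : 2 < degree t v by rewrite vr.
      by move: v3; rewrite (degree_rooted rt v) (introT eqP vr).
    have := cardsD1 c S; have := cardsD1 c' (S :\ c); move: v3.
    by case: (c \in S); case: (c' \in _); clear; lia.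
  by case/card_gt0P=> z; rewrite !inE => /and3P[? ? /andP[? /eqP ?]]; exists z.
have sub x y a : par x = v -> par y = v -> x != r -> y != r -> x != y ->
    anc x a -> anc y a = false.
  by move=> px py xr yr xy; apply: (siblings_disjoint rt); rewrite ?px.
have H x y : leaf x -> e v x -> par y = v -> y != r -> y != z -> anc y x -> e z x = false.
  move=> x1 vx py yr yz yx; apply/negP => zx.
  have := outer_leaf_parent x1 zx zr (sub y z x py pz yr zr yz yx).
  by rewrite pz vr; move: r_branch; clear; lia.
have zx x y : anc y x -> par y = v -> y != r -> y != z -> z != x.
  move=> yx py yr yz; apply/eqP => E.
  by have := sub y z x py pz yr zr yz yx; rewrite E anc_refl.
have cz : c != z by rewrite eq_sym.
have cz' : c' != z by rewrite eq_sym.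
apply: (key z); [exact: vc | exact: zx cu pc cr cz | exact: zx cu' pc' cr' cz' | |].
- exact: H u1 vu pc cr cz cu.
- exact: H u1' vu' pc' cr' cz' cu'.
Qed.

(** Otherwise [u], [u'] and the parent of [v] form a claw at [v]. *)
Lemma outer_leaf_unique v u u' : leaf u -> leaf u' -> v != r ->
  e v u -> e v u' -> anc v u = false -> anc v u' = false -> u = u'.
Proof.
move=> u1 u1' vr vu vu' au au'; apply/eqP; case: (boolP (u == u')) => // ne.
have ne' : u' != u by rewrite eq_sym.
have p2 := parent_degree_gt1 rt r_branch vr.
have vp : e v (par v) by case: gt => -[_ sub _ _] _; apply/sub/(rooting_rel_par rt).
have pneq x : leaf x -> par v != x by move=> x1; apply: contraTneq p2 => ->; rewrite x1.
have := claw vp vu vu' (pneq _ u1) (pneq _ u1') ne.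
rewrite (leaves_independent gt u1 u1') (outer_leaf_parent_nbr u1 u1' ne vu vr au).
by rewrite (outer_leaf_parent_nbr u1' u1 ne' vu' vr au').
Qed.

Definition has_inner_leaf v := [exists u, [&& degree t u == 1, e v u & anc v u]].
Definition has_outer_leaf v := [exists u, [&& degree t u == 1, e v u & ~~ anc v u]].

Lemma has_inner_leafP v :
  reflect (exists u, [/\ leaf u, e v u & anc v u]) (has_inner_leaf v).
Proof.
apply: (iffP existsP) => -[u]; first by case/and3P=> /eqP; exists u.
by case=> /eqP u1 vu au; exists u; apply/and3P.
Qed.

Lemma has_outer_leafP v :
  reflect (exists u, [/\ leaf u, e v u & anc v u = false]) (has_outer_leaf v).
Proof.
apply: (iffP existsP) => -[u]; first by case/and3P=> /eqP ? ? /negbTE ?; exists u.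
by case=> /eqP u1 vu nvu; exists u; rewrite u1 vu nvu.
Qed.

Lemma outer_leaf_root v : has_outer_leaf v -> v != r.
Proof.
by case/has_outer_leafP=> u [_ _]; apply: contraFneq => ->; apply: root_anc rt _.
Qed.

(** An inner leaf neighbour of [par v] can only be [u]; as [u] is not below [v], [par v] would have
    a second child and degree at least 3. *)
Lemma outer_leaf_parent_inner v : has_outer_leaf v ->
  degree t (par v) = 2 /\ has_inner_leaf (par v) = false.
Proof.
move=> ov; have vr := outer_leaf_root ov.
case/has_outer_leafP: ov => u [u1 vu au].
have q2 := outer_leaf_parent u1 vu vr au.
split=> //; case: has_inner_leafP => // -[u' [u1' qu' aqu']].
have [E|ne] := eqVneq u u'; last first.
  by have := outer_leaf_parent_nbr u1 u1' ne vu vr au; rewrite qu'.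
subst u'; have qu : par v != u by apply: contraPneq u1 => <-; rewrite q2.
have [c [cr pc cu]] := child_toward rt aqu' qu.
have [cv|ncv] := eqVneq c v; first by rewrite -cv cu in au.
have := children_degree rt cr vr pc erefl ncv; rewrite q2.
by have [E|] := eqVneq (par v) r; first by move: r_branch; rewrite -E q2.
Qed.

Lemma leaf_nbr_le v : degree t v != 1 ->
  #|[set u in leaves t | e u v]| <= has_inner_leaf v + has_outer_leaf v.
Proof.
move=> v1; have v2 : 1 < degree t v.
  by have := good_degree_gt0 v gt; case: (degree t v) v1 => [|[|n]].
rewrite -(cardsID [set u | anc v u]) leq_add //.
  case: (set_0Vmem ([set u in leaves t | e u v] :&: [set u | anc v u])) => [->|[u]].
    by rewrite cards0.
  rewrite !inE e_sym => /andP[/andP[/eqP u1 vu] au].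
  have -> : has_inner_leaf v by apply/has_inner_leafP; exists u.
  apply: (@leq_trans #|[set u]|); last by rewrite cards1.
  apply/subset_leq_card/subsetP => u'.
  rewrite !inE e_sym => /andP[/andP[/eqP u1' vu'] au'].
  by apply/eqP; apply: inner_leaf_unique v2 _ _ _ _.
case: (set_0Vmem ([set u in leaves t | e u v] :\: [set u | anc v u])) => [->|[u]].
  by rewrite cards0.
rewrite !inE e_sym => /and3P[/negbTE au /eqP u1 vu].
have ov : has_outer_leaf v by apply/has_outer_leafP; exists u.
rewrite ov; apply: (@leq_trans #|[set u]|); last by rewrite cards1.
apply/subset_leq_card/subsetP => u'.
rewrite !inE e_sym => /and3P[/negbTE au' /eqP u1' vu'].
by apply/eqP; apply: outer_leaf_unique (outer_leaf_root ov) _ _ _ _.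
Qed.

(* Inner leaf neighbours are charged to [v] itself, outer ones and the vertices
   of [X] to the parent of [v]. *)
Lemma leaf_degree_sum (X S : {set T}) :
  (forall v, v \in X -> [/\ degree t v != 1, v != r, has_outer_leaf v = false,
     degree t (par v) = 2 & has_inner_leaf (par v) = false]) ->
  (forall v, v \in S -> 2 < degree t v /\ has_inner_leaf v = false) ->
  \sum_(u in leaves t) degree e u + #|X| + #|S| + l <= #|T|.
Proof.
move=> XP SP.
pose F := [set v | (degree t v != 1) && has_inner_leaf v].
pose O := [set v | (degree t v != 1) && has_outer_leaf v].
have OP v : v \in O -> [/\ v != r, degree t (par v) = 2 & has_inner_leaf (par v) = false].
  rewrite inE => /andP[_ ov]; have [? ?] := outer_leaf_parent_inner ov.
  by split=> //; apply: outer_leaf_root.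
have EP v : v \in O :|: X -> [/\ v != r, degree t (par v) = 2 & has_inner_leaf (par v) = false].
  by rewrite inE => /orP[/OP//|/XP[]].
(* A charged parent has degree 2 and is not the root, so it has a single child and [par] is
   injective here. *)
have cardE : #|par @: (O :|: X)| = #|O| + #|X|.
  rewrite card_in_imset => [|v v' /EP[vr q2 _] /EP[vr' _ _] E].
    rewrite cardsU (_ : O :&: X = set0) ?cards0 ?subn0 //.
    apply/setP => v; rewrite in_set0; apply/negP; rewrite inE => /andP[].
    by rewrite inE => /andP[_ ov] /XP[_ _]; rewrite ov.
  apply/eqP; case: (boolP (v == v')) => // ne.
  have := children_degree rt vr vr' erefl (esym E) ne; rewrite q2.
  by have [E'|] := eqVneq (par v) r; first by move: r_branch; rewrite -E' q2.
have sumL : \sum_(u in leaves t) degree e u <= #|F| + #|O|.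
  rewrite (eq_bigr (fun u => \sum_v e u v)); last by move=> u _; rewrite degreeE.
  rewrite exchange_big /=.
  rewrite -!sum_indicator -big_split /=.
  apply: leq_sum => v _; rewrite !inE.
  have [v1|v1] := eqVneq (degree t v) 1.
    rewrite big1 // => u; rewrite inE => /eqP u1.
    by rewrite (leaves_independent gt u1 v1).
  apply: leq_trans (leaf_nbr_le v1); rewrite -sum1_card big_mkcond [leqRHS]big_mkcond.
  by apply: leq_sum => u _; rewrite !inE; case: (_ == _).
rewrite -(good_card gt).
apply: (@leq_trans (#|F| + #|par @: (O :|: X)| + #|S| + #|leaves t|)).
  by rewrite cardE; move: sumL; clear; lia.
(* The four sets are disjoint: members of [F] are non-leaves with an inner leaf neighbour, charged
   parents have degree 2 and members of [S] at least 3, both without inner leaf neighbours. *)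
rewrite -[leqRHS]sum1_card -!sum_indicator -!big_split /=.
apply: leq_sum => v _.
have HE : v \in par @: (O :|: X) -> degree t v = 2 /\ has_inner_leaf v = false.
  by case/imsetP=> x /EP[_ q2 qi] ->.
have HS := SP v.
case: (boolP (v \in F)); rewrite inE ?negb_and.
  case/andP=> v1 iv; case: (boolP (v \in _ @: _)) => [/HE[_]|_]; first by rewrite iv.
  case: (boolP (v \in S)) => [/HS[_]|_]; first by rewrite iv.
  by rewrite inE (negbTE v1).
move=> _; case: (boolP (v \in _ @: _)) => [/HE[v2 _]|_].
  case: (boolP (v \in S)) => [/HS[]|_]; first by rewrite v2.
  by rewrite inE v2.
case: (boolP (v \in S)) => [/HS[v3 _]|_]; last by case: (v \in _).
by rewrite inE; case: eqP v3 => // ->.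
Qed.

End BranchRoot.

(** * Two branch vertices at minimal distance *)

Hypothesis cubic : forall t v, good t -> degree t v <= 3.
Variable m : nat.
Hypothesis m_min : forall t r par dep v, good t -> rooting t r par dep ->
  2 < degree t r -> 2 < degree t v -> v != r -> m <= dep v.

(** Quantifying over all rootings at [b] makes the depth of [b'] a distance; by [m_min] it equals
    [m]. *)
Definition closest_branches t b b' :=
  [/\ good t, 2 < degree t b, 2 < degree t b', b' != b
    & forall par dep, rooting t b par dep -> dep b' <= m].

Lemma tree_edge t r par dep c : good t -> rooting t r par dep -> c != r -> e c (par c).
Proof. by case=> -[_ sub _ _] _ rt cr; apply/sub/(rooting_rel_par rt). Qed.

Lemma closest_branches_sym t b b' : closest_branches t b b' -> closest_branches t b' b.
Proof.
case=> gt b3 b3' ne bm; split=> //; first by rewrite eq_sym.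
move=> par' dep' rt'; have [par [dep rt]] := stree_rooting e_irr b gt.1.
apply: leq_trans (bm _ _ rt).
have [] := dep_up rt rt' (root_anc rt b') => [c _ _ cr|].
  by apply: (rooting_rel_par rt); apply: contraNneq cr => ->.
by rewrite (rt_dep0 rt) (rt_dep0 rt'); lia_at b.
Qed.

Section ClosestBranches.

Variables (t : rel T) (b : T) (par : T -> T) (dep : T -> nat) (b' : T).
Hypotheses (cf : closest_branches t b b') (rt : rooting t b par dep).
Local Notation anc := (anc par).
Local Notation leaf u := (degree t u = 1).

Let gt : good t. Proof. by case: cf. Qed.
Let b3 : 2 < degree t b. Proof. by case: cf. Qed.
Let b3' : 2 < degree t b'. Proof. by case: cf. Qed.
Let bb' : b' != b. Proof. by case: cf. Qed.

(** [v] lies strictly between [b] and [b'] and its path to [b'] is kept, so as a branch vertex it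
    would be at distance less than [m] from [b']. *)
Lemma swap_not_closer D A v : good (swap t par D A) -> anc v b' -> v != b -> v != b' ->
  all (fun d => anc d b' ==> anc d v) D ->
  2 < degree (swap t par D A) v -> 2 < degree (swap t par D A) b' -> False.
Proof.
move=> gt' vb' nvb nvb' /allP aD v3 b3''.
have [par' [dep' rt']] := stree_rooting e_irr v gt'.1.
have [] := dep_up rt rt' vb' => [c vc cb' cv|].
  apply: (swap_keep rt); first apply: contraNneq nvb => E.
    by rewrite E in vc; apply/eqP/(anc_root_eq rt).
  by apply/negP => /aD; rewrite cb' /= => /(anc_antisym rt vc) E; rewrite E eqxx in cv.
have := m_min gt' rt' v3 b3''; rewrite eq_sym nvb' => /(_ isT).
case: cf => _ _ _ _ /(_ _ _ rt); rewrite (rt_dep0 rt') (rt_dep rt nvb).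
by clear; lia.
Qed.

Lemma swap_closest D A : good (swap t par D A) -> all (fun d => ~~ anc d b') D ->
  2 < degree (swap t par D A) b -> 2 < degree (swap t par D A) b' ->
  closest_branches (swap t par D A) b b'.
Proof.
move=> gt' /allP aD b3'' b3'''; split=> // par' dep' rt'.
have [] := dep_up rt rt' (root_anc rt b') => [c _ cb' cb|].
  by apply: (swap_keep rt) => //; apply/negP => /aD; rewrite cb'.
case: cf => _ _ _ _ /(_ _ _ rt); rewrite (rt_dep0 rt') (rt_dep0 rt).
by clear; lia.
Qed.

Record fork y z w : Prop := Fork {
  fork_y : y != b; fork_z : z != b; fork_w : w != b;
  fork_py : par y = b; fork_pz : par z = b; fork_pw : par w = b;
  fork_yz : y != z; fork_yw : y != w; fork_zw : z != w;
  fork_b' : anc w b';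
  fork_all : forall c, c != b -> par c = b -> [|| c == y, c == z | c == w] }.

Lemma fork_sym y z w : fork y z w -> fork z y w.
Proof.
case=> yb zb wb py pz pw yz yw zw wb' H; split=> // [|c cb pc]; first by rewrite eq_sym.
by rewrite orbCA; apply: H.
Qed.

Lemma exists_fork : exists y z w, fork y z w.
Proof.
have bb : b != b' by rewrite eq_sym.
have [w [wb pw wb']] := child_toward rt (root_anc rt b') bb.
pose S := [set c | (c != b) && (par c == b)].
have cS : #|S :\ w| = 2.
  have := degree_rooted rt b; rewrite eqxx -/S /= => dE.
  have := cardsD1 w S; rewrite inE wb pw eqxx /=.
  by have := cubic b gt; move: b3; rewrite dE; clear; lia.
have /cards2P[y [z [yz E]]] : #|S :\ w| == 2 by rewrite cS.
have SP c : c \in S :\ w = (c == y) || (c == z) by rewrite E !inE.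
have := SP y; have := SP z; rewrite !eqxx orbT !inE.
case/and3P=> zw zb /eqP pz /and3P[yw yb /eqP py].
exists y, z, w; split=> // c cb pc; have := SP c; rewrite !inE cb pc eqxx andbT.
by rewrite orbA => <-; case: (c == w).
Qed.

Lemma fork_child y z w a : fork y z w -> a != b -> [|| anc y a, anc z a | anc w a].
Proof.
move=> fk; rewrite eq_sym => /(child_toward rt (root_anc rt a))[c [cb pc ca]].
by case/or3P: (fork_all fk cb pc) => /eqP <-; rewrite ca ?orbT.
Qed.

Lemma fork_disjoint y z w a : fork y z w -> anc y a ->
  anc z a = false /\ anc w a = false.
Proof.
case=> yb zb wb py pz pw yz yw zw _ _ ya.
by split; apply: (siblings_disjoint rt) ya => //; rewrite ?py ?pz ?pw.
Qed.

Lemma fork_disjoint_w y z w a : fork y z w -> anc w a ->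
  anc y a = false /\ anc z a = false.
Proof.
case=> yb zb wb py pz pw yz yw zw _ _ wa.
by split; apply: (siblings_disjoint rt) wa => //; rewrite ?py ?pz ?pw // eq_sym.
Qed.

Lemma fork_up y z w a : fork y z w -> anc y a -> par a != b -> anc y (par a).
Proof.
move=> fk ya pa; apply: anc_up ya _; apply: contraNneq pa => <-.
by rewrite (fork_py fk).
Qed.

Lemma child_root c : c != b -> anc c b = false.
Proof. by move=> cb; apply: contraNF cb => /(anc_root_eq rt)->. Qed.

(** Otherwise the paths to [a] and [b'] part at a branch vertex strictly between [b] and [b']. *)
Lemma fork_w_chain y z w a : fork y z w -> anc w a -> anc b' a || anc a b'.
Proof.
move=> fk wa; apply: contraT; rewrite negb_or => /andP[nba nab].
have [v [c [cb pc ca cb' vb']]] := branching rt nab.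
have va : anc v a by rewrite -pc; apply: anc_trans (par_anc _ _) ca.
have nvb' : v != b' by apply: contraNneq nba => <-.
have nvb : v != b.
  apply/eqP => E; rewrite E in pc; have := fork_b' fk.
  have [wy wz] := fork_disjoint_w fk wa.
  by case/or3P: (fork_all fk cb pc) ca cb' => /eqP->; rewrite ?wy ?wz // => _ ->.
have [c' [cb2 pc' cb3]] := child_toward rt vb' nvb'.
have cc' : c != c' by apply: contraTneq cb3 => <-; rewrite cb'.
have := children_degree rt cb cb2 pc pc' cc'; rewrite nvb => v3.
have := m_min gt rt b3 v3 nvb; case: cf => _ _ _ _ /(_ _ _ rt) le1 le2.
by case/eqP: nvb'; apply: (anc_dep_eq rt) vb' _; apply: leq_trans le1 le2.
Qed.

Lemma fork_w_leaf y z w u : fork y z w -> anc w u -> leaf u -> anc b' u /\ b' != u.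
Proof.
move=> fk wu u1; have ne : b' != u by apply: contraTneq b3' => ->; rewrite u1.
split=> //; case/orP: (fork_w_chain fk wu) => //.
by rewrite (leaf_anc rt) // eq_sym (negbTE ne).
Qed.

Lemma fork_w_degree y z w : fork y z w -> 1 < degree t w.
Proof.
move=> fk; have [->|ne] := eqVneq w b'; first exact: ltnW b3'.
exact: inner_not_leaf rt b3 _ _ (fork_b' fk) ne.
Qed.

Lemma degree_root : degree t b = 3.
Proof. by apply/eqP; rewrite eqn_leq cubic. Qed.

(** Replacing [y b] by [y w] creates no leaf and raises the degree of [w]: either [w] is [b'] and
    reaches degree 4, or it becomes a branch vertex nearer to [b']. *)
Lemma fork_not_adjacent y z w : fork y z w -> e y w = false.
Proof.
move=> fk; case yw : (e y w) => //; have w2 := fork_w_degree fk.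
case: (fk) => yb zb wb py pz pw nyz nyw nzw wb' _.
have [yw0 _] := fork_disjoint_w fk (anc_refl par w).
have [yb0 _] := fork_disjoint_w fk wb'.
have [u u1] := good_leaf gt.
have [] := @swap_good t b par dep gt rt [:: y] [:: (y, w)] u u u1 => //=.
- by by_neq.
- by rewrite yw.
- by rewrite andbT; via w; [edge | up].
- by move=> a a0; rewrite py; have := degree_at a b3; lia_at a.
rewrite py; set t' := swap _ _ _ _ => gt' E.
have w3 : 2 < degree t' w by have := E w; neqs; move: w2; clear; lia.
have [wE|ne] := eqVneq w b'.
  have := E w; have := cubic w gt'; neqs; move: b3'; rewrite -wE; clear; lia.
have b3'' : 2 < degree t' b'.
  by have := E b'; move: b3'; rewrite [b == _]eq_sym (negbTE bb'); lia_at b'.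
by case: (swap_not_closer gt' wb' wb ne _ w3 b3''); by_anc.
Qed.

Lemma fork_adjacent y z w : fork y z w -> e y z.
Proof.
move=> fk; have E c : c != b -> par c = b -> e b c.
  by move=> cb <-; rewrite e_sym; apply: tree_edge gt rt cb.
have yw := fork_not_adjacent fk; have zw := fork_not_adjacent (fork_sym fk).
case: fk => yb zb wb py pz pw nyz nyw nzw _ _.
by have := claw (E y yb py) (E z zb pz) (E w wb pw) nyz nyw nzw; rewrite yw zw !orbF.
Qed.

(** Replacing [z b] by [y z] loses a leaf if [y] is one, and gives degree 4 if [y] is a branch
    vertex. *)
Lemma fork_degree y z w : fork y z w -> degree t y = 2.
Proof.
move=> fk; have yz := fork_adjacent fk.
case: (fk) => yb zb wb py pz pw nyz nyw nzw wb' _.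
have [zy0 _] := fork_disjoint fk (anc_refl par y).
have z0 : all (fun c => connect (swap t par [:: z] [:: (y, z)]) c b) [:: z].
  by rewrite /= andbT; via y; [edge | up].
have [y1|y1] := eqVneq (degree t y) 1.
  case: (@swap_absurd t b par dep gt rt [:: z] [:: (y, z)] y y1) => //=.
  - by by_neq.
  - by rewrite yz.
  - by move=> a a0; rewrite pz; have := degree_at a b3; lia_at a.
have [y3|] := ltnP 2 (degree t y); last first.
  by move=> y2; have := good_degree_gt0 y gt; case: (degree t y) y1 y2 => [|[|[|]]].
have [u u1] := good_leaf gt.
have [] := @swap_good t b par dep gt rt [:: z] [:: (y, z)] u u u1 => //=.
- by by_neq.
- by rewrite yz.
- by move=> a a0; rewrite pz; have := degree_at a b3; lia_at a.
move=> gt' E; have := E y; have := cubic y gt'; rewrite pz; neqs.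
by move: y3; clear; lia.
Qed.

(** Replacing [y b] and [z b] by [y z] and [b u] leaves [b] with degree 2 and loses the leaf [u]. *)
Lemma fork_leaf_not_adjacent y z w u : fork y z w -> leaf u -> anc y u -> e b u = false.
Proof.
move=> fk u1 yu; case bu : (e b u) => //; have yz := fork_adjacent fk.
case: (fk) => yb zb wb py pz pw nyz nyw nzw wb' _.
have [zu _] := fork_disjoint fk yu.
case: (@swap_absurd t b par dep gt rt [:: y; z] [:: (y, z); (b, u)] u u1) => //=.
- by by_neq.
- by by_neq.
- by rewrite yz bu.
- set t' := swap _ _ _ _; have yb0 : connect t' y b by via u; [down | edge].
  by rewrite yb0 andbT; via y; [edge |].
- by move=> a a0; rewrite py pz; have := degree_at a b3; lia_at a.
Qed.

(** A leaf below [w] is below [b']; cutting under [b'] towards it and adding [b u] would give [b]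
    degree 4. *)
Lemma closest_root_leaf u : leaf u -> e b u = false.
Proof.
move=> u1; case bu : (e b u) => //.
have [y [z [w fk]]] := exists_fork.
have ub : u != b := leaf_neq_root b3 u1.
case/or3P: (fork_child fk ub) => wu.
- by rewrite (fork_leaf_not_adjacent fk) in bu.
- by rewrite (fork_leaf_not_adjacent (fork_sym fk)) in bu.
have [b'u nb'u] := fork_w_leaf fk wu u1.
have [c [cb pc cu]] := child_toward rt b'u nb'u.
have [] := @swap_good t b par dep gt rt [:: c] [:: (b, u)] u c u1 => //=.
- by by_neq.
- by rewrite bu.
- by rewrite andbT; via u; [down | edge].
- by move=> a a0; rewrite pc; have := degree_at a b3'; lia_at a.
move=> gt' E; have := E b; have := cubic b gt'; rewrite pc degree_root; neqs.
by clear; lia.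
Qed.

End ClosestBranches.

(** * Neighbours of the root that are not its children *)

Section RootNeighbours.

Variables (t : rel T) (b : T) (par : T -> T) (dep : T -> nat) (b' : T).
Hypotheses (cf : closest_branches t b b') (rt : rooting t b par dep).
Local Notation anc := (anc par).
Local Notation leaf u := (degree t u = 1).
Local Notation fork := (fork b par b').

Let gt : good t. Proof. by case: cf. Qed.
Let b3 : 2 < degree t b. Proof. by case: cf. Qed.
Let b3' : 2 < degree t b'. Proof. by case: cf. Qed.
Let bb' : b' != b. Proof. by case: cf. Qed.
Let dB : degree t b = 3. Proof. exact: degree_root cf. Qed.

Lemma closest_end_leaf u : leaf u -> e b' u = false.
Proof.
have [par' [dep' rt']] := stree_rooting e_irr b' gt.1.
exact: closest_root_leaf (closest_branches_sym cf) rt' _.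
Qed.

(** Replacing [y b] by [v u] trades the leaf [u] for at most [y] and makes [v] a branch vertex
    nearer to [b']. *)
Lemma interior_leaf_outside y z w v u : fork y z w -> anc v b' -> v != b -> v != b' ->
  leaf u -> e v u -> anc y u -> False.
Proof.
move=> fk vb' vb nvb' u1 vu yu.
have v2 : 1 < degree t v := inner_not_leaf rt b3 vb' nvb'.
have wv : anc w v.
  case/orP: (anc_total (fork_b' fk) vb') => // vw.
  have [<-|nvw] := eqVneq v w; first exact: anc_refl.
  have := anc_up vw nvw; rewrite (fork_pw fk) => /(anc_root_eq rt) E.
  by rewrite E eqxx in vb.
have [yv _] := fork_disjoint_w rt fk wv; have [yb' _] := fork_disjoint_w rt fk (fork_b' fk).
have yv' : y != v by apply: contraFneq yv => ->; apply: anc_refl.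
have nyb' : y != b' by apply: contraFneq yb' => ->; apply: anc_refl.
have yb := fork_y fk; have py := fork_py fk.
have [] := @swap_good t b par dep gt rt [:: y] [:: (v, u)] u y u1 => //=.
- by by_neq.
- by rewrite vu.
- by rewrite andbT; via u; [down | via v; [edge | up]].
- by move=> a a0; rewrite py; have := degree_at a b3; lia_at a.
move=> gt' E; apply: (swap_not_closer cf rt gt' vb' vb nvb').
- by by_anc.
- by have := E v; rewrite py; neqs; move: v2; clear; lia.
- by have := E b'; rewrite py; neqs; move: b3'; clear; lia.
Qed.

Section Neighbour.

Variable v : T.
Hypotheses (bv : e b v) (vb : v != b) (qb : par v != b).
Local Notation q := (par v).

Lemma nbr_not_leaf : 1 < degree t v.
Proof.
have := good_degree_gt0 v gt; case: (ltngtP (degree t v) 1) => // v1 _.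
by have := bv; rewrite (closest_root_leaf cf rt v1).
Qed.

(** Otherwise moving [v] from its parent to [b] creates no leaf and gives [b] degree 4. *)
Lemma nbr_parent_degree : degree t q = 2.
Proof.
have q2 := parent_degree_gt1 rt b3 vb; apply/eqP; rewrite eqn_leq q2 andbT leqNgt.
apply/negP => q3; have [u u1] := good_leaf gt.
have [] := @swap_good t b par dep gt rt [:: v] [:: (b, v)] u u u1 => //=.
- by by_neq.
- by rewrite bv.
- by rewrite andbT; edge.
- by move=> a a0; have := degree_at a q3; lia_at a.
move=> gt' E; have := E b; have := cubic b gt'; rewrite dB; neqs.
by clear; lia.
Qed.

Lemma nbr_parent_child c : c != b -> par c = q -> c = v.
Proof.
move=> cb pc; apply/eqP; case: (boolP (c == v)) => // ne.
by have := children_degree rt cb vb pc erefl ne; rewrite nbr_parent_degree qb.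
Qed.

Lemma nbr_parent_anc u : leaf u -> anc q u -> anc v u.
Proof.
move=> u1 qu; have ne : q != u.
  by apply: contraPneq u1 => <-; rewrite nbr_parent_degree.
by have [c [cb /(nbr_parent_child cb)-> vu]] := child_toward rt qu ne.
Qed.

Lemma nbr_parent_neq : q != b'.
Proof. by apply: contraTneq b3' => <-; rewrite nbr_parent_degree. Qed.

(** Opening the triangle to [y z], moving [v] to [b] and adding [q u] loses the leaf [u] and gains
    none. *)
Lemma nbr_parent_inner_y y z w u : fork y z w -> anc y v ->
  leaf u -> e q u -> anc v u -> False.
Proof.
move=> fk yv u1 qu vu; have yq := fork_up fk yv qb.
have yu := anc_trans yv vu; have yz := fork_adjacent cf rt fk.
have [zu _] := fork_disjoint rt fk yu; have [zq _] := fork_disjoint rt fk yq.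
have [zv _] := fork_disjoint rt fk yv.
have vq := anc_parF rt vb.
have yb := fork_y fk; have zb := fork_z fk; have py := fork_py fk; have pz := fork_pz fk.
have nyz := fork_yz fk.
have nyv : y != v by apply: contraNneq qb => <-; rewrite py.
have nzv : z != v by apply: contraNneq qb => <-; rewrite pz.
case: (@swap_absurd t b par dep gt rt [:: y; z; v] [:: (y, z); (b, v); (q, u)] u u1) => //=.
- by by_neq.
- by by_neq.
- by rewrite yz bv qu.
- set t' := swap _ _ _ _; have v0 : connect t' v b by edge.
  have y0 : connect t' y b by via (par v); [down | via u; [edge | via v; [up |]]].
  rewrite y0 v0 /= andbT; by via y; [edge |].
- by move=> a a0; rewrite py pz; have := degree_at a b3; lia_at a.
Qed.

(** Moving [v] to [b] and replacing the edge below [b'] towards [u] by [q u] gives [b] degree 4. *)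
Lemma nbr_parent_inner_w y z w u : fork y z w -> anc w v ->
  leaf u -> e q u -> anc v u -> False.
Proof.
move=> fk wv u1 qu vu.
have [b'u nb'u] := fork_w_leaf cf rt fk (anc_trans wv vu) u1.
have [c [cb pc cu]] := child_toward rt b'u nb'u.
have ncv : c != v by apply: contraNneq nbr_parent_neq => <-; rewrite pc.
have vq := anc_parF rt vb; have nqb' := nbr_parent_neq.
have [] := @swap_good t b par dep gt rt [:: v; c] [:: (b, v); (q, u)] u c u1 => //=.
- by by_neq.
- by by_neq.
- by rewrite bv qu.
- set t' := swap _ _ _ _; have v0 : connect t' v b by edge.
  (* The route to [b] depends on which of [v] and [c], both ancestors of [u], is above the other. *)
  rewrite v0 /= andbT; case/orP: (anc_total vu cu) => [vc|cv].
    have cq : anc c q = false by apply: contraFF vq => /(anc_trans vc).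
    by via u; [down | via (par v); [edge | up]].
  have cq : anc c q := anc_up cv ncv.
  by via (par v); [down | via u; [edge | via v; [up |]]].
- by move=> a a0; rewrite pc; have := degree_at a b3'; lia_at a.
move=> gt' E; have := E b; have := cubic b gt'; rewrite dB pc; neqs.
by clear; lia.
Qed.

Lemma nbr_parent_inner : has_inner_leaf t par q = false.
Proof.
case: has_inner_leafP => // -[u [u1 qu au]]; have vu := nbr_parent_anc u1 au.
have [y [z [w fk]]] := exists_fork cf rt.
case/or3P: (fork_child rt fk vb) => av.
- by case: (nbr_parent_inner_y fk av u1 qu vu).
- by case: (nbr_parent_inner_y (fork_sym fk) av u1 qu vu).
- by case: (nbr_parent_inner_w fk av u1 qu vu).
Qed.

(* The tree loses [b y], [b z] and the edge below the branch vertex [m0], and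
   [v] ends up with degree at least 4. *)
Lemma nbr_outer_cut y z w u c m0 : fork y z w -> anc y v -> leaf u -> e v u ->
  c != b -> par c = m0 -> 2 < degree t m0 -> m0 != b -> m0 != v ->
  anc c u -> anc c v = false -> anc z u = false -> c != y -> c != z ->
  (anc y u ==> anc y c) -> False.
Proof.
move=> fk yv u1 vu cb pc m3 mb mv cu cv zu ncy ncz yuc.
have yz := fork_adjacent cf rt fk; have [zv _] := fork_disjoint rt fk yv.
have yb := fork_y fk; have zb := fork_z fk; have py := fork_py fk; have pz := fork_pz fk.
have nyz := fork_yz fk.
have nyv : y != v by apply: contraNneq qb => <-; rewrite py.
have nzv : z != v by apply: contraNneq qb => <-; rewrite pz.
have ncv : c != v by apply: contraFneq cv => ->; apply: anc_refl.
have [] := @swap_good t b par dep gt rt [:: y; z; c] [:: (y, z); (b, v); (v, u)] u c u1 => //=.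
- by by_neq.
- by by_neq.
- by rewrite yz bv vu.
- set t' := swap _ _ _ _; have v0 : connect t' v b by edge.
  have y0 : connect t' y b by via v; [down |].
  rewrite y0 /= andbT; apply/andP; split; first by via y; [edge |].
  via u; last by via v; [edge |].
  rewrite (swap_connect_sym rt); apply: (swap_connect_up rt) => //=.
  by rewrite yuc zu anc_refl implybT.
- by move=> a a0; rewrite py pz pc; have := degree_at a b3;
    have := degree_at a m3; have := neq_at a mb; lia_at a.
move=> gt' E; have := E v; have := cubic v gt'; rewrite py pz pc; neqs.
by have := nbr_not_leaf; clear; lia.
Qed.

(** First, [v] has degree 2: otherwise opening the triangle to [y z] and adding [b v] would give it
    degree 4. Then the claw condition at [v] is applied to [par v], [b] and the only child [x] of
    [v]. *)
Lemma nbr_outer_opposite y z w u : fork y z w -> anc y v -> leaf u -> e v u ->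
  anc z u -> False.
Proof.
move=> fk yv u1 vu zu.
have yz := fork_adjacent cf rt fk; have [zv _] := fork_disjoint rt fk yv.
have [yu _] := fork_disjoint rt (fork_sym fk) zu.
have yq := fork_up fk yv qb; have [zq _] := fork_disjoint rt fk yq.
have yb := fork_y fk; have zb := fork_z fk; have py := fork_py fk; have pz := fork_pz fk.
have nyz := fork_yz fk; have [yb' zb'] := fork_disjoint_w rt fk (fork_b' fk).
have nyv : y != v by apply: contraNneq qb => <-; rewrite py.
have nzv : z != v by apply: contraNneq qb => <-; rewrite pz.
have vq := anc_parF rt vb.
have vu0 : anc v u = false by apply: contraFF yu => /(anc_trans yv).
have v2 : degree t v = 2.
  apply/eqP; rewrite eqn_leq nbr_not_leaf andbT leqNgt; apply/negP => v3.
  have [] := @swap_good t b par dep gt rt [:: y; z] [:: (y, z); (b, v)] u u u1 => //=.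
  - by by_neq.
  - by by_neq.
  - by rewrite yz bv.
  - set t' := swap _ _ _ _; have y0 : connect t' y b by via v; [down | edge].
    by rewrite y0 andbT; via y; [edge |].
  - by move=> a a0; rewrite py pz; have := degree_at a b3; lia_at a.
  move=> gt' E; have := E v; have := cubic v gt'; rewrite py pz; neqs.
  by move: v3; clear; lia.
have [x xb px] : exists2 x, x != b & par x = v.
  have := degree_rooted rt v; rewrite v2 vb => /eqP; rewrite eqSS eq_sym => /eqP cS.
  have /card_gt0P[x] : 0 < #|[set c | (c != b) && (par c == v)]| by rewrite cS.
  by rewrite inE => /andP[xb /eqP px]; exists x.
have vx : anc v x by rewrite -px; apply: par_anc.
have xv : anc x v = false by rewrite -px (anc_parF rt).
have xu : anc x u = false by apply: contraFF vu0 => /(anc_trans vx).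
have xq : anc x q = false by apply: contraFF vq => /(anc_trans vx).
have zx : anc z x = false by have [] := fork_disjoint rt fk (anc_trans yv vx).
have xb' : anc x b' = false by apply: contraFF yb' => /(anc_trans (anc_trans yv vx)).
have vb' : anc v b' = false by apply: contraFF yb' => /(anc_trans yv).
have anc_neq a c : anc a c = false -> a != c by apply: contraFneq => ->; apply: anc_refl.
have nyx : y != x by rewrite eq_sym; apply: contraFneq xv => ->.
have nzx := anc_neq _ _ zx; have nxv := anc_neq _ _ xv; have nvq := anc_neq _ _ vq.
have nxq := anc_neq _ _ xq; have nxb' := anc_neq _ _ xb'; have nzb' := anc_neq _ _ zb'.
have nvb' := anc_neq _ _ vb'.
have evq := tree_edge gt rt vb; have := tree_edge gt rt xb; rewrite px e_sym => evx.
have evb : e v b by rewrite e_sym.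
have nqx : q != x by rewrite eq_sym.
(* In the first two cases the edge [q x] or [q b] allows an exchange that loses the leaf [u] and
   gains none. *)
case/or3P: (claw evq evx evb nqx qb xb) => [qx|qb0|xb0].
- case: (@swap_absurd t b par dep gt rt [:: y; z; v; x]
    [:: (y, z); (b, v); (q, x); (v, u)] u u1) => //=.
  + by by_neq.
  + by by_neq.
  + by rewrite yz bv qx vu.
  + set t' := swap _ _ _ _; have v0 : connect t' v b by edge.
    have z0 : connect t' z b by via u; [down | via v; [edge |]].
    have y0 : connect t' y b by via z; [edge |].
    rewrite y0 z0 v0 /= andbT; by via (par v); [edge | via y; [up |]].
  + by move=> a a0; rewrite py pz px; have := degree_at a b3; lia_at a.
- case: (@swap_absurd t b par dep gt rt [:: y; z; v]
    [:: (y, z); (q, b); (v, u)] u u1) => //=.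
  + by by_neq.
  + by by_neq.
  + by rewrite yz qb0 vu.
  + set t' := swap _ _ _ _; have y0 : connect t' y b by via (par v); [down | edge].
    have z0 : connect t' z b by via y; [edge |].
    rewrite y0 z0 /= andbT; by via u; [edge | via z; [up |]].
  + by move=> a a0; rewrite py pz; have := degree_at a b3; lia_at a.
(* In the last case [z] becomes a leaf adjacent to [b] in [e], while [b] and [b'] stay a closest
   pair. *)
have z2 := fork_degree cf rt (fork_sym fk).
have nuz : u != z by apply: contraPneq u1 => ->; rewrite z2.
have [] := @swap_good t b par dep gt rt [:: x; z] [:: (x, b); (v, u)] u z u1 => //=.
- by by_neq.
- by by_neq.
- by rewrite xb0 vu.
- set t' := swap _ _ _ _; have x0 : connect t' x b by edge.
  rewrite x0 /= andbT; by via u; [down | via v; [edge | up]].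
- by move=> a a0; rewrite px pz; have := degree_at a b3; lia_at a.
set t' := swap _ _ _ _ => gt' E.
have cf' : closest_branches t' b b'.
  apply: (swap_closest cf rt gt'); first by by_anc.
    by rewrite -/t'; have := E b; rewrite dB px pz; neqs; clear; lia.
  by rewrite -/t'; have := E b'; rewrite px pz; neqs; move: b3'; clear; lia.
have z1 : degree t' z = 1 by have := E z; rewrite px pz z2; neqs; clear; lia.
have [par' [dep' rt']] := stree_rooting e_irr b gt'.1.
have := closest_root_leaf cf' rt' z1; have := tree_edge gt rt zb.
by rewrite pz e_sym => ->.
Qed.

(** The edge cut is below [b'] if [u] is below [w], and below the last common ancestor of [u] and
    [v] if [u] is below [y]. *)
Lemma nbr_outer_y y z w u : fork y z w -> anc y v -> leaf u -> e v u ->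
  anc v u = false -> False.
Proof.
move=> fk yv u1 vu vu0; have nvu : u != v by apply: contraTneq nbr_not_leaf => <-; rewrite u1.
have ub : u != b := leaf_neq_root b3 u1.
case/or3P: (fork_child rt fk ub) => au; last 1 first.
- have [b'u nb'u] := fork_w_leaf cf rt fk au u1.
  have [c [cb pc cu]] := child_toward rt b'u nb'u.
  have [yu zu] := fork_disjoint_w rt fk au.
  have wb' := fork_b' fk; have [zv wv] := fork_disjoint rt fk yv.
  have b'v : anc b' v = false by apply: contraFF wv => /(anc_trans wb').
  have cv : anc c v = false
    by apply: contraFF b'v => H; rewrite -pc; apply: anc_trans (par_anc _ _) H.
  apply: (nbr_outer_cut fk yv u1 vu cb pc b3' bb' _ cu cv zu); rewrite ?yu //.
  + by apply: contraFneq b'v => ->; apply: anc_refl.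
  + by apply: contraFneq yu => <-.
  + by apply: contraFneq zu => <-.
- have [m0 [c [cb pc cu cv [mv nmv mu nmu m3]]]] := branching_leaf rt b3 u1 nvu (negbT vu0).
  have [zu wu] := fork_disjoint rt fk au.
  have ncy : c != y by apply: contraFneq cv => ->.
  have yc : anc y c.
    case/orP: (anc_total au cu) => // /anc_up/(_ ncy).
    by rewrite (fork_py fk) (child_root rt cb).
  apply: (nbr_outer_cut fk yv u1 vu cb pc m3 _ nmv cu cv zu ncy); rewrite ?yc ?implybT //.
    apply: contraNneq ncy => E; rewrite E in pc.
    case/or3P: (fork_all fk cb pc) => // /eqP cE; first by rewrite cE zu in cu.
    by rewrite cE wu in cu.
  by apply: contraFneq zu => <-.
- exact: nbr_outer_opposite fk yv u1 vu au.
Qed.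

(** A place of [v] strictly between [b] and [b'] is excluded by [interior_leaf_outside]. Below [b'],
    the claw condition at [v] is applied to [par v], [b] and [u]. *)
Lemma nbr_outer_w y z w u : fork y z w -> anc w v -> leaf u -> e v u ->
  anc v u = false -> False.
Proof.
move=> fk wv u1 vu vu0; have [vb'|nvb'] := boolP (anc v b').
  have [E|ne] := eqVneq v b'; first by rewrite E (closest_end_leaf u1) in vu.
  have ub : u != b := leaf_neq_root b3 u1.
  case/or3P: (fork_child rt fk ub) => au.
  - exact: interior_leaf_outside fk vb' vb ne u1 vu au.
  - exact: interior_leaf_outside (fork_sym fk) vb' vb ne u1 vu au.
  have [b'u _] := fork_w_leaf cf rt fk au u1.
  by rewrite (anc_trans vb' b'u) in vu0.
have b'v : anc b' v by case/orP: (fork_w_chain cf rt fk wv) nvb' => // ->.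
have nb'v : b' != v by apply: contraNneq nvb' => <-; apply: anc_refl.
have b'q := anc_up b'v nb'v; have q2 := nbr_parent_degree.
have nqb' := nbr_parent_neq; have wq := anc_trans (fork_b' fk) b'q.
have vq := anc_parF rt vb.
have nuq : u != q by apply: contraPneq u1 => ->; rewrite q2.
have qu0 : anc q u = false by apply/negP => /(nbr_parent_anc u1); rewrite vu0.
have bu := closest_root_leaf cf rt u1.
have evq := tree_edge gt rt vb; have evb : e v b by rewrite e_sym.
have nqu : q != u by rewrite eq_sym.
have nbu : b != u by rewrite eq_sym (leaf_neq_root b3 u1).
(* Moving [v] to [b] gives [b] degree 4; a cut below a branch vertex other than [b] makes room for
   the edge [q u]. *)
have cut c m0 : c != b -> par c = m0 -> 2 < degree t m0 -> m0 != b -> m0 != q -> e q u ->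
    connect (swap t par [:: v; c] [:: (b, v); (q, u)]) c b -> False.
  move=> cb pc m3 mb mq qu c0.
  have nvc : v != c by apply: contraNneq mq => E; rewrite -pc -E.
  have [] := @swap_good t b par dep gt rt [:: v; c] [:: (b, v); (q, u)] u c u1 => //=.
  - by by_neq.
  - by by_neq.
  - by rewrite bv qu.
  - by rewrite c0 !andbT; edge.
  - by move=> a a0; rewrite pc; have := degree_at a m3; lia_at a.
  move=> gt' E; have := E b; have := cubic b gt'; rewrite dB pc; neqs.
  by clear; lia.
case/or3P: (claw evq evb vu qb nqu nbu) => [qb0|qu|]; last by rewrite bu.
  (* The exchange makes [q] a leaf adjacent to [b] and keeps [b], [b'] a closest pair. *)
  have [gt' E] := swap_to_outer_leaf gt rt u1 vu vb vu0 q2.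
  set t' := swap _ _ _ _ in gt' E.
  have ub' : u != b' by apply: contraTneq b3' => <-; rewrite u1.
  have cf' : closest_branches t' b b'.
    apply: (swap_closest cf rt gt'); first by rewrite /= nvb'.
      by rewrite -/t'; have := E b; rewrite dB; neqs; clear; lia.
    by rewrite -/t'; have := E b'; neqs; move: b3'; clear; lia.
  have q1 : degree t' q = 1 by have := E q; rewrite q2; neqs; clear; lia.
  have [par' [dep' rt']] := stree_rooting e_irr b gt'.1.
  by have := closest_root_leaf cf' rt' q1; rewrite e_sym qb0.
have [m0 [c [cb pc cu cq [mq nmq mu nmu m3]]]] := branching_leaf rt b3 u1 nuq (negbT qu0).
(* If the paths to [u] and [q] part at [b], the cut is made below [b'] towards [q] instead. *)
have [mb|mb] := eqVneq m0 b; last first.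
  by apply: (cut c m0) => //; via u; [down | via (par v); [edge | up]].
have nb'q : b' != q by rewrite eq_sym.
have [c' [cb' pc' cq']] := child_toward rt b'q nb'q.
apply: (cut c' b') => //.
have wu0 : anc w u = false.
  rewrite mb in pc; case/or3P: (fork_all fk cb pc) => /eqP cE; rewrite cE in cu cq.
  - by have [] := fork_disjoint rt fk cu.
  - by have [] := fork_disjoint rt (fork_sym fk) cu.
  - by rewrite wq in cq.
have c'u : anc c' u = false.
  apply: contraFF wu0 => H; apply: anc_trans (fork_b' fk) _.
  by rewrite -pc'; apply: anc_trans (par_anc _ _) H.
by via (par v); [down | via u; [edge | up]].
Qed.

Lemma nbr_outer : has_outer_leaf t par v = false.
Proof.
case: has_outer_leafP => // -[u [u1 vu vu0]].
have [y [z [w fk]]] := exists_fork cf rt.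
case/or3P: (fork_child rt fk vb) => av.
- by case: (nbr_outer_y fk av u1 vu vu0).
- by case: (nbr_outer_y (fork_sym fk) av u1 vu vu0).
- by case: (nbr_outer_w fk av u1 vu vu0).
Qed.

End Neighbour.

(** The set consists of [b] and the leaves. All neighbours of [b] but its three children go into the
    charging as [X], and [b], [b'] are the uncharged vertices [S] there. *)
Lemma closest_branches_independent :
  exists S : {set T}, [/\ independent e S, #|S| = l.+1
    & \sum_(v in S) degree e v + l <= #|T| + 1].
Proof.
have bL : b \notin leaves t by rewrite inE dB.
exists (b |: leaves t); split.
- apply/forall_inP => x xS; apply/forall_inP => x' xS'; move: xS xS'; rewrite !inE.
  move=> /orP[/eqP->|/eqP x1] /orP[/eqP->|/eqP x1']; rewrite ?e_irr //.
  + by rewrite (closest_root_leaf cf rt).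
  + by rewrite e_sym (closest_root_leaf cf rt).
  + by rewrite (leaves_independent gt x1 x1').
- by rewrite cardsU1 bL (good_card gt).
rewrite big_setU1 //=.
pose C := [set c | (c != b) && (par c == b)].
pose X := [set v | e b v] :\: C.
have XP v : v \in X -> [/\ e b v, v != b & par v != b].
  rewrite !inE => /andP[nC bv]; have vb : v != b by apply: contraTneq bv => ->; rewrite e_irr.
  by rewrite vb in nC.
have cC : #|C| = 3 by have := degree_rooted rt b; rewrite dB eqxx.
have dbX : degree e b <= #|X| + 3.
  by rewrite /degree -(cardsID C) addnC leq_add2l -cC subset_leq_card // subsetIr.
have inner_end x : x \in [set b; b'] -> 2 < degree t x /\ has_inner_leaf t par x = false.
  by rewrite !inE => /orP[]/eqP->; split=> //; case: has_inner_leafP => // -[u [u1]];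
    rewrite ?(closest_root_leaf cf rt u1) ?(closest_end_leaf u1).
have := leaf_degree_sum gt rt b3 _ inner_end (X := X).
rewrite cards2 eq_sym bb' => H; have {}H := H _.
have arith d x s n : d <= x + 3 -> s + x + 2 + l <= n -> d + s + l <= n + 1.
  by clear; lia.
apply: arith dbX (H _) => v /XP[bv vb qb]; split=> //.
- by rewrite neq_ltn nbr_not_leaf ?orbT.
- exact: nbr_outer bv vb qb.
- exact: nbr_parent_degree bv vb qb.
- exact: nbr_parent_inner bv vb qb.
Qed.

End RootNeighbours.

End FewestLeaves.

(** * Degree sums, leaf numbers and the conclusion *)

Lemma sigma_le (T : finType) (e : rel T) (S : {set T}) :
  independent e S -> (sigma e #|S| <= (\sum_(v in S) degree e v)%N%:Z%:E)%E.
Proof.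
move=> iS; rewrite /sigma ltnNge (leq_bigmax_cond (F := fun A : {set T} => #|A|) S iS) /=.
by apply: Order.TotalTheory.bigmin_le_cond; rewrite iS eqxx.
Qed.

Lemma independentS (T : finType) (e : rel T) (A B : {set T}) :
  A \subset B -> independent e B -> independent e A.
Proof.
move=> /subsetP AB /forall_inP iB; apply/forall_inP => x xA; apply/forall_inP => y yA.
by have /forall_inP/(_ y (AB y yA)) := iB x (AB x xA).
Qed.

Lemma exists_subset_card (T : finType) (A : {set T}) n :
  n <= #|A| -> exists2 B : {set T}, B \subset A & #|B| = n.
Proof.
move=> le; exists [set x in take n (enum A)].
  by apply/subsetP => x; rewrite inE => /mem_take; rewrite mem_enum.
have u : uniq (take n (enum A)) by rewrite take_uniq // enum_uniq.
rewrite cardsE (card_uniqP u) size_take -cardE.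
by case: ltnP => // ge; apply/eqP; rewrite eqn_leq le ge.
Qed.

(** Truncated subtraction makes leaves contribute 0, so a degree plus its leaf indicator is 2 plus
    the excess; this is summed over all vertices. *)
Lemma stree_leaves (T : finType) (e t : rel T) : irreflexive e -> 1 < #|T| ->
  stree e t -> #|leaves t| = 2 + \sum_v (degree t v - 2).
Proof.
move=> e_irr T_gt1 st; have [_ _ _ sumt] := st.
have H : \sum_v (degree t v + (v \in leaves t)) = \sum_(v : T) 2 + \sum_v (degree t v - 2).
  rewrite -big_split /=; apply: eq_bigr => v _; rewrite inE.
  have := stree_degree_gt0 e_irr v T_gt1 st; case: (degree t v) => [|[|d]] //= _.
  by rewrite addn0 !subSS subn0.
have arith n s x y : 1 < n -> s = n * 2 -> 2 * n.-1 + x = s + y -> x = 2 + y.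
  by clear; lia.
move: H; rewrite big_split /= sumt sum_indicator.
exact: arith T_gt1 (sum_nat_const _ _).
Qed.

Theorem corollary1p12 (k : nat) (T : finType) (e : rel T)
    (k_gt0 : 0 < k)
    (e_simple : simple_graph e)
    (e_connected : connected_graph e)
    (e_claw_free : claw_free e)
    (sigma_ge : ((#|T|%:Z - k%:Z - 1)%R%:E <= sigma e (k + 4))%E) :
  exists t : rel T, spanning_tree e t /\ #|branch_vertices t| <= k.
Proof.
have [//|no] := classic (exists t : rel T, spanning_tree e t /\ #|branch_vertices t| <= k).
have [e_sym e_irr] := e_simple; have claw := claw_free_adjacent e_simple e_claw_free.
have many t : stree e t -> k < #|branch_vertices t|.
  move=> st; rewrite ltnNge; apply/negP => le; apply: no; exists t; split=> //.
  by apply: (stree_spanning_tree e_irr) st; case: e_connected.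
have [t0 st0] := exists_stree e_sym e_irr e_connected.
have T_gt1 : 1 < #|T|.
  have /card_gt0P[v] : 0 < #|branch_vertices t0| by apply: leq_trans (many _ st0).
  rewrite inE => v3; apply: leq_trans (max_card [set u | t0 v u]).
  exact: ltnW v3.
have bound (S : {set T}) : independent e S -> #|S| = k + 4 ->
    #|T| <= \sum_(v in S) degree e v + k + 1.
  move=> iS cS; have := sigma_le iS; rewrite cS => /(Order.POrderTheory.le_trans sigma_ge).
  by rewrite lee_fin; lia.
have leavesE t st := @stree_leaves T e t e_irr T_gt1 st.
have branch_le (t : rel T) : #|branch_vertices t| <= \sum_v (degree t v - 2).
  rewrite -sum_indicator; apply: leq_sum => v _; rewrite inE.
  by case: ltnP; lia.
have [l [t1 st1 E1] l_min'] : exists2 l, (exists2 t, stree e t & #|leaves t| = l)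
    & forall l', (exists2 t, stree e t & #|leaves t| = l') -> l <= l'.
  by apply: nat_minimum; exists #|leaves t0|, t0.
have l_min t : stree e t -> l <= #|leaves t| by move=> st; apply: l_min'; exists t.
have gt1 : good e l t1 by split=> //; rewrite E1.
(* Each of the more than [k] branch vertices adds at least 1 to the sum in [stree_leaves]. *)
have l_ge : k + 3 <= l.
  by have := leavesE _ st1; have := branch_le t1; have := many _ st1; rewrite E1; lia.
have l_ge3 : 2 < l by lia.
(* Any [k + 4] of the leaves are independent with degree sum at most [#|T| - l], too little for
   [bound]. *)
have [l4|l3] := leqP (k + 4) l.
  have [r r3] := good_branch e_irr l_min l_ge3 gt1.
  have [par [dep rt]] := stree_rooting e_irr r st1.
  have := @leaf_degree_sum T e l e_sym e_irr claw l_min l_ge3 t1 r par dep gt1 rt r3 set0 set0.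
  rewrite !cards0 !addn0 => H; have {}H := H _ _.
  have [S SL cS] : exists2 S : {set T}, S \subset leaves t1 & #|S| = k + 4.
    by apply: exists_subset_card; rewrite E1.
  have iL : independent e (leaves t1).
    apply/forall_inP => x; rewrite inE => /eqP x1; apply/forall_inP => y; rewrite inE => /eqP y1.
    by rewrite (leaves_independent e_sym e_irr l_min l_ge3 gt1 x1 y1).
  have le_S : \sum_(v in S) degree e v <= \sum_(v in leaves t1) degree e v.
    rewrite big_mkcond [leqRHS]big_mkcond; apply: leq_sum => v _.
    by case: ifP => // /(subsetP SL)->.
  have arith s s' n : n <= s + k + 1 -> s <= s' -> s' + l <= n -> False.
    by move: l4; clear; lia.
  case: (arith _ _ _ (bound _ (independentS SL iL) cS) le_S (H _ _)).
    by move=> v; rewrite inE.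
  by move=> v; rewrite inE.
(* Now the excesses [degree - 2] sum to at most [k + 1], and more than [k] branch vertices share
   them, so each excess is at most 1. *)
have cubic t v : good e l t -> degree t v <= 3.
  case=> st le; rewrite leqNgt; apply/negP => v4.
  have : #|branch_vertices t| < \sum_v (degree t v - 2).
    rewrite -sum_indicator (bigD1 v) //= [ltnRHS](bigD1 v) //= inE (ltnW v4) add1n.
    apply: (@leq_add 2); first by move: v4; clear; lia.
    by apply: leq_sum => x _; rewrite inE; case: ltnP; clear; lia.
  have := leavesE _ st; have := many _ st; move: le l3.
  by move: #|_| #|_| (\sum_v _); clear; lia.
pose at_distance m t r v := exists par dep, [/\ good e l t, rooting t r par dep,
  2 < degree t r /\ 2 < degree t v, v != r & dep v = m].
have [m [t [b [b' [par [dep [gt rt [b3 b3'] bb' bm]]]]]] m_min'] :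
    exists2 m, (exists t r v, at_distance m t r v)
      & forall m', (exists t r v, at_distance m' t r v) -> m <= m'.
  (* As [k] is positive, [t1] has two branch vertices. *)
  apply: nat_minimum; have /card_gt1P[r [v [r3 v3 rv]]] : 1 < #|branch_vertices t1|.
    exact: leq_trans (many _ st1).
  have [par [dep rt]] := stree_rooting e_irr r st1.
  exists (dep v), t1, r, v, par, dep; rewrite !inE in r3 v3.
  by split=> //; rewrite eq_sym.
have m_min t' r par' dep' v : good e l t' -> rooting t' r par' dep' ->
    2 < degree t' r -> 2 < degree t' v -> v != r -> m <= dep' v.
  by move=> *; apply: m_min'; exists t', r, v, par', dep'.
have cf : closest_branches e l m t b b'.
  split=> // par' dep' rt'; rewrite -bm.
  have [] := dep_up rt rt' (root_anc rt b') => [c _ _ cb|].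
    exact: (rooting_rel_par rt).
  by rewrite (rt_dep0 rt) (rt_dep0 rt') addn0.
have [S [iS cS sumS]] :=
  closest_branches_independent e_sym e_irr claw l_min l_ge3 cubic m_min cf rt.
have lk : l = k + 3 by apply/eqP; rewrite eqn_leq l_ge andbT; move: l3; clear; lia.
(* The degree sum is at most [#|T| - k - 2], one less than [bound] demands. *)
have arith s n : n <= s + k + 1 -> s + l <= n + 1 -> False.
  by rewrite lk; clear; lia.
by case: (arith _ _ (bound S iS _) sumS); rewrite cS lk -addnS.
Qed.
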